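(* Suppose assumptions A1), A2), A3), A4), A5) and A6) (stated in the context) hold. Then for all $(s,z)\in[0,\infty)\times\mathbb{R}^n$ the value function $V$ possesses the maximal property $$V(s,z)\ge\max\{\Phi(s,z) : \Phi\text{ is a Dini sub-solution of the HJB equation}\},$$ that is, $V(s,z)\ge\Phi(s,z)$ for every Dini sub-solution $\Phi$. Furthermore, for all $(s,z)\in[0,\infty)\times\mathbb{R}^n$, it possesses the minimal property $$V(s,z)\le\min\{\Phi(s,z) : \Phi\text{ is a Dini super-solution of the HJB equation}\},$$ that is, $V(s,z)\le\Phi(s,z)$ for every Dini super-solution $\Phi$.
   Context: Data: $l:[0,\infty)\times\mathbb{R}^n\times\mathbb{R}^m\to\mathbb{R}$ and $f:[0,\infty)\times\mathbb{R}^n\times\mathbb{R}^m\to\mathbb{R}^n$ are given functions, $\Omega\subset\mathbb{R}^m$ is a nonempty set (admissible control actions), and $\delta>0$ is the discount rate. For $(\tau,z)\in[0,\infty)\times\mathbb{R}^n$ let $U_{ad}[\tau,\infty):=\{w\in L^1_{loc}([\tau,\infty);\mathbb{R}^m) : w(t)\in\Omega \text{ a.e. in } [\tau,\infty)\}$. An admissible process for the initial condition $(\tau,z)$ is a pair $(x,u)$ with $u\in U_{ad}[\tau,\infty)$ and $x$ a (locally) absolutely continuous function on $[\tau,\infty)$ with $x(t)=z+\int_\tau^t f(s,x(s),u(s))\,ds$ for $t\ge\tau$. Its cost is $J(u;\tau,z):=\int_\tau^\infty e^{-\delta t}l(t,x(t),u(t))\,dt$. Let $\mathcal{D}_{\tau,z;\infty}$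 be the set of admissible processes $(x,u)$ for $(\tau,z)$ with $J(u;\tau,z)<\infty$. Value function: $V:[0,\infty)\times\mathbb{R}^n\to\mathbb{R}$ (real-valued), $V(\tau,z):=\inf\{J(u;\tau,z) : (x,u)\in\mathcal{D}_{\tau,z;\infty}\}$. Hamiltonian: $\mathcal{H}(t,x,\lambda):=\inf_{u\in\Omega}\{\langle\lambda,f(t,x,u)\rangle+e^{-\delta t}l(t,x,u)\}$ for $(t,x,\lambda)\in[0,\infty)\times\mathbb{R}^n\times\mathbb{R}^n$. The HJB equation is $\partial_t v(t,x)+\mathcal{H}(t,x,\partial_x v(t,x))=0$, $(t,x)\in(0,\infty)\times\mathbb{R}^n$. For $\Phi:[0,\infty)\times\mathbb{R}^n\to\mathbb{R}$: the lower Dini derivative at $(t,x)$ in direction $(\alpha,\xi)\in\mathbb{R}^{1+n}$ is $D^-\Phi(t,x;\alpha,\xi):=\liminf_{r\downarrow0;\,w\to\xi}\frac{\Phi(t+r\alpha,x+rw)-\Phi(t,x)}{r}$; the upper Dini derivative $D^+\Phi$ is defined with $\limsup$ instead. Dini sub-gradient: $\partial_D\Phi(t,x):=\{(\alpha,\xi)\in\mathbb{R}^{1+n} : D^-\Phi(t,x;u,v)\ge u\alpha+\langle v,\xi\rangle\ \forall(u,v)\in\mathbb{R}^{1+n}\}$. Dini super-gradient: $\partial^D\Phi(t,x):=\{(\alpha,\xi)\in\mathbb{R}^{1+n} : D^+\Phi(t,x;u,v)\le u\alpha+\langle v,\xi\rangle\ \forall(u,v)\in\mathbb{R}^{1+n}\}$.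 Consider the conditions on a continuous $\Phi$: (a) for all $(\tau,z)\in[0,\infty)\times\mathbb{R}^n$, $\alpha+\mathcal{H}(\tau,z,\xi)\ge0$ for all $(\alpha,\xi)\in\partial^D\Phi(\tau,z)$; (b) $\Phi(\tau,z)\to0$ as $\tau\to\infty$, uniformly for $z$ in each compact subset of $\mathbb{R}^n$; (c) for all $(\tau,z)\in[0,\infty)\times\mathbb{R}^n$, $\alpha+\mathcal{H}(\tau,z,\xi)\le0$ for all $(\alpha,\xi)\in\partial_D\Phi(\tau,z)$. A continuous $\Phi$ is a Dini sub-solution if it satisfies (a) and (b), and a Dini super-solution if it satisfies (b) and (c). Assumptions: A1) There exists $K_1>0$ such that for every $t\in[0,\infty)$, $u\in\Omega$: $|l(t,x,u)-l(t,z,u)|+|f(t,x,u)-f(t,z,u)|\le K_1|x-z|$ for all $x,z\in\mathbb{R}^n$. A2) There exists $K_2>0$ such that $|l(t,x,u)|+|f(t,x,u)|\le K_2(1+|x|)$ for all $t\in[0,\infty)$, $x\in\mathbb{R}^n$, $u\in\Omega$. A3) $l$ and $f$ are continuous. A4) For all $t,x$, the set $\{(e^{-\delta t}l(t,x,v),f(t,x,v))^T : v\in\Omega\}$ is convex in $\mathbb{R}^{n+1}$. A5) $\Omega$ is compact. A6) Given $(\tau,z)\in[0,\infty)\times\mathbb{R}^n$, there exists a bounded set $\mathcal{S}_{\tau,z}\subset\mathbb{R}^n$ such that every $(x,u)\in\mathcal{D}_{\tau,z;\infty}$ satisfies $x(t)\in\mathcal{S}_{\tau,z}$ for $t\ge\tau$.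 *)

(* Defs.v *)
(* R^k is 'rV[R]_k.  Functions of time are total on R; only
   their values at times t >= 0 (resp. t >= tau) are ever used. *)
From HB Require Import structures.
From mathcomp Require Import all_boot all_order all_algebra.
From mathcomp Require Import all_classical all_reals all_analysis measurable_realfun.

Set Implicit Arguments.
Unset Strict Implicit.
Unset Printing Implicit Defensive.

Import Order.TTheory GRing.Theory Num.Theory.
Import numFieldNormedType.Exports.

Local Open Scope classical_set_scope.
Local Open Scope ring_scope.

Section Euclidean.
Context {R : realType} {k : nat}.
Implicit Types x y : 'rV[R]_k.

Definition dot x y : R := \sum_(i < k) x 0 i * y 0 i.

(* The library norm `|x| on 'rV[R]_k is the sup norm. *)
Definition enorm x : R := Num.sqrt (dot x x).

(* a, b list the endpoints of finitely many non-overlapping subintervals. *)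
Definition abs_continuous (s t : R) (x : R -> 'rV[R]_k) : Prop :=
  forall e : R, 0 < e -> exists2 d : R, 0 < d &
    forall (N : nat) (a b : 'I_N -> R),
      (forall i, s <= a i /\ a i <= b i /\ b i <= t) ->
      (forall i j, i != j -> b i <= a j \/ b j <= a i) ->
      \sum_(i < N) (b i - a i) < d ->
      \sum_(i < N) enorm (x (b i) - x (a i)) < e.

End Euclidean.

Section ControlProblem.
Context {R : realType} {n m : nat}.
Variables (l : R -> 'rV[R]_n -> 'rV[R]_m -> R)
          (f : R -> 'rV[R]_n -> 'rV[R]_m -> 'rV[R]_n)
          (Omega : set 'rV[R]_m) (delta : R).

Local Notation mu := (@lebesgue_measure R).

Definition admissible_control (tau : R) (u : R -> 'rV[R]_m) : Prop :=
  (forall T i, tau <= T ->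
     mu.-integrable `[tau, T] (fun t => (u t 0 i)%:E)) /\
  {ae mu, forall t, tau <= t -> Omega (u t)}.

Definition admissible_process (tau : R) (z : 'rV[R]_n)
    (x : R -> 'rV[R]_n) (u : R -> 'rV[R]_m) : Prop :=
  [/\ admissible_control tau u,
      forall T, tau <= T -> abs_continuous tau T x,
      forall T i, tau <= T ->
        mu.-integrable `[tau, T] (fun s => (f s (x s) (u s) 0 i)%:E) &
      forall t i, tau <= t ->
        x t 0 i = z 0 i + \int[mu]_(s in `[tau, t]) (f s (x s) (u s) 0 i)].

Definition running_cost (x : R -> 'rV[R]_n) (u : R -> 'rV[R]_m) (t : R)
    : \bar R :=
  (expR (- (delta * t)) * l t (x t) (u t))%:E.

Definition cost (tau : R) (x : R -> 'rV[R]_n) (u : R -> 'rV[R]_m) : \bar R :=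
  (\int[mu]_(t in `[tau, +oo[) running_cost x u t)%E.

(* \int assigns the value -oo to the undefined form +oo - +oo, which must not
   count as a cost < +oo. *)
Definition cost_defined (tau : R) (x : R -> 'rV[R]_n) (u : R -> 'rV[R]_m)
    : Prop :=
  let g := running_cost x u in
  measurable_fun (`[tau, +oo[ : set (measurableTypeR R)) g /\
  ((\int[mu]_(t in `[tau, +oo[) (g^\+ t) < +oo)%E \/
   (\int[mu]_(t in `[tau, +oo[) (g^\- t) < +oo)%E).

Definition finite_cost_process (tau : R) (z : 'rV[R]_n)
    (x : R -> 'rV[R]_n) (u : R -> 'rV[R]_m) : Prop :=
  [/\ admissible_process tau z x u, cost_defined tau x u &
      (cost tau x u < +oo)%E].

Definition value_function (tau : R) (z : 'rV[R]_n) : \bar R :=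
  ereal_inf [set j | exists x u,
    finite_cost_process tau z x u /\ j = cost tau x u].

Definition hamiltonian (t : R) (x lambda : 'rV[R]_n) : \bar R :=
  ereal_inf [set (dot lambda (f t x u) + expR (- (delta * t)) * l t x u)%:E
            | u in Omega].

(* Pairs (r, w) with r -> 0+ and w -> xi for which t + r * alpha stays in
   [0, +oo[.  The restriction only matters at t = 0 with alpha < 0, where no
   such r exists: then the lower derivative is +oo and the upper one -oo. *)
Definition dini_filter (t alpha : R) (xi : 'rV[R]_n)
    : set_system (R * 'rV[R]_n) :=
  within [set p | 0 <= t + p.1 * alpha] (filter_prod 0^'+ (nbhs xi)).

Implicit Type Phi : R -> 'rV[R]_n -> R.

Definition dini_quotient Phi (t : R) (x : 'rV[R]_n) (alpha : R)
    (p : R * 'rV[R]_n) : \bar R :=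
  ((Phi (t + p.1 * alpha) (x + p.1 *: p.2) - Phi t x) / p.1)%:E.

Definition lower_dini Phi (t : R) (x : 'rV[R]_n) (alpha : R) (xi : 'rV[R]_n)
    : \bar R :=
  limf_einf (dini_quotient Phi t x alpha) (dini_filter t alpha xi).

Definition upper_dini Phi (t : R) (x : 'rV[R]_n) (alpha : R) (xi : 'rV[R]_n)
    : \bar R :=
  limf_esup (dini_quotient Phi t x alpha) (dini_filter t alpha xi).

Definition dini_subgradient Phi (t : R) (x : 'rV[R]_n)
    : set (R * 'rV[R]_n) :=
  [set q | forall (u : R) (v : 'rV[R]_n),
     ((u * q.1 + dot v q.2)%:E <= lower_dini Phi t x u v)%E].

Definition dini_supergradient Phi (t : R) (x : 'rV[R]_n)
    : set (R * 'rV[R]_n) :=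
  [set q | forall (u : R) (v : 'rV[R]_n),
     (upper_dini Phi t x u v <= (u * q.1 + dot v q.2)%:E)%E].

Definition continuous_on_domain Phi : Prop :=
  {within [set p : R * 'rV[R]_n | 0 <= p.1],
    continuous (fun p : R * 'rV[R]_n => Phi p.1 p.2)}.

Definition vanishes_at_infinity Phi : Prop :=
  forall K : set 'rV[R]_n, compact K -> forall e : R, 0 < e ->
    \forall tau \near +oo, forall z, K z -> `|Phi tau z| < e.

Definition dini_subsolution Phi : Prop :=
  [/\ continuous_on_domain Phi,
      forall tau z alpha xi, 0 <= tau ->
        dini_supergradient Phi tau z (alpha, xi) ->
        (0 <= alpha%:E + hamiltonian tau z xi)%E &
      vanishes_at_infinity Phi].

Definition dini_supersolution Phi : Prop :=
  [/\ continuous_on_domain Phi,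
      vanishes_at_infinity Phi &
      forall tau z alpha xi, 0 <= tau ->
        dini_subgradient Phi tau z (alpha, xi) ->
        (alpha%:E + hamiltonian tau z xi <= 0)%E].

End ControlProblem.

(* Main.v *)
Require Import Defs.
From HB Require Import structures.
From mathcomp Require Import all_boot all_order all_algebra.
From mathcomp Require Import all_classical all_reals all_analysis measurable_realfun.
From mathcomp Require Import ring lra.

Set Implicit Arguments.
Unset Strict Implicit.
Unset Printing Implicit Defensive.

Import Order.TTheory GRing.Theory Num.Theory.
Import numFieldNormedType.Exports.

Local Open Scope classical_set_scope.
Local Open Scope ring_scope.

(** The proof compares the value function with a continuous sub- or
super-solution by regularization; no differentiability of the latter is used.

Let Psi be continuous.  On a compact slab of times and states consider the
inf-convolution Theta (t, x) = min over (t', y) of Psi (t', y) plus the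
penalty a (t - t')^2 + b |x - y|^2 ([inf_convolution]).  It is close to Psi,
and a minimizer (t', y) for (t, x) carries the slope
q = (2 a (t - t'), 2 b (x - y)), which is a proximal subgradient of Psi at
(t', y), hence a Dini subgradient ([proximal_sub_dini]).  Testing the minimum
that defines Theta at a later point with the old minimizer gives
Theta (t + h, x + D) <= Theta (t, x) + h q.1 + <D, q.2> + O(h^2).  When D is the
increment of a trajectory, h q.1 + <D, q.2> is the integral of
q.1 + <f, q.2> along it, and the velocity may be evaluated at (t', y) instead
of at the trajectory: the space weight b makes b |x - y|^2 small, which
controls the Lipschitz part of the change of f against the slope, and the time
weight a is chosen after b, so large that |t - t'| controls the merely
continuous dependence of f on time.  Summing over many short steps of length h
yields an inequality on a finite horizon ([regularized_step]).

For a sub-solution Phi take Psi = - Phi.  The Hamilton-Jacobi inequality at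
(t', y) holds for every control value, so the argument applies to an arbitrary
process of finite cost, with its measurable control
([subsolution_horizon]): Phi (s, z) <= Phi (T, x (T)) + cost on [s, T].
For a super-solution take Psi = Phi.  The inequality holds for some control
value, up to a small error; that value is used as a constant control during
the next step, its trajectory being given by Picard iteration
([constant_control_process]), and one obtains a process with
Phi (T, x (T)) + cost on [s, T] <= Phi (s, z) + error
([supersolution_horizon]).

In both cases T tends to infinity.  The states of the processes stay in one
bounded set.  For a process of finite cost this is an assumption; any other
process can be continued, from any of its points, by a process of finite cost,
since the value function is finite there, and the continued process has finite
cost ([process_bounded]).  On a bounded set Phi (T, x (T)) vanishes in the
limit, and the cost after time T is at most a constant times
exp (- delta T). *)

(** * Supremum norm and scalar product of row vectors *)

Section Norms.
Context {R : realType} {k : nat}.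
Implicit Types x y z : 'rV[R]_k.

Lemma dotDl x y z : dot (x + y) z = dot x z + dot y z.
Proof. by rewrite /dot -big_split; apply: eq_bigr => i _; rewrite mxE mulrDl. Qed.

Lemma dotC x y : dot x y = dot y x.
Proof. by apply: eq_bigr => i _; rewrite mulrC. Qed.

Lemma dotZl a x y : dot (a *: x) y = a * dot x y.
Proof. by rewrite /dot mulr_sumr; apply: eq_bigr => i _; rewrite mxE mulrA. Qed.

Lemma dotNl x y : dot (- x) y = - dot x y.
Proof. by rewrite -scaleN1r dotZl mulN1r. Qed.

Lemma dotDr x y z : dot z (x + y) = dot z x + dot z y.
Proof. by rewrite dotC dotDl !(dotC z). Qed.

Lemma dotZr a x y : dot y (a *: x) = a * dot y x.
Proof. by rewrite dotC dotZl dotC. Qed.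

Lemma dotNr x y : dot y (- x) = - dot y x.
Proof. by rewrite dotC dotNl dotC. Qed.

Lemma dotxx_ge0 x : 0 <= dot x x.
Proof. by apply: sumr_ge0 => i _; rewrite -expr2 sqr_ge0. Qed.

Lemma normE x i : `|x 0 i| <= `|x|.
Proof.
rewrite {2}/Num.norm/= mx_normrE.
exact: (le_bigmax _ (fun j : 'I_1 * 'I_k => `|x j.1 j.2|) (0, i)).
Qed.

Lemma norm_leP x (c : R) : 0 <= c -> (forall i, `|x 0 i| <= c) -> `|x| <= c.
Proof.
move=> c0 H; rewrite /Num.norm/= mx_normrE.
by apply: bigmax_le => // -[i j] _ /=; rewrite ord1.
Qed.

Lemma norm_dot x y : `|dot x y| <= k%:R * (`|x| * `|y|).
Proof.
rewrite (le_trans (ler_norm_sum _ _ _))//.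
rewrite -[k in k%:R]card_ord -sum1_card natr_sum mulr_suml; apply: ler_sum => i _.
by rewrite mul1r normrM ler_pM ?normE.
Qed.

Lemma sqr_norm_le_dot x : `|x| ^+ 2 <= dot x x.
Proof.
rewrite -[leRHS]sqr_sqrtr ?dotxx_ge0// ler_pXn2r ?nnegrE ?sqrtr_ge0//.
apply: norm_leP => [|i]; first exact: sqrtr_ge0.
rewrite -sqrtr_sqr ler_wsqrtr// /dot (bigD1 i)//= expr2 lerDl.
by apply: sumr_ge0 => j _; rewrite -expr2 sqr_ge0.
Qed.

Lemma norm_le_enorm x : `|x| <= enorm x.
Proof.
by rewrite -[`|x|]normr_id -sqrtr_sqr ler_wsqrtr ?sqr_norm_le_dot.
Qed.

Lemma enorm_le_norm x : enorm x <= k%:R * `|x|.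
Proof.
rewrite /enorm -[leRHS]ger0_norm ?mulr_ge0// -sqrtr_sqr ler_wsqrtr//.
rewrite (le_trans (ler_norm _))// (le_trans (norm_dot _ _))//.
rewrite exprMn -expr2 ler_wpM2r ?sqr_ge0//.
by rewrite -natrX ler_nat; case: (k) => // j; rewrite expnS leq_pmulr.
Qed.

Lemma enorm_ge0 x : 0 <= enorm x. Proof. exact: sqrtr_ge0. Qed.

Lemma continuous_dot (T : topologicalType) (F G : T -> 'rV[R]_k) :
  continuous F -> continuous G -> continuous (fun t => dot (F t) (G t)).
Proof.
move=> cF cG t; apply: cvg_big => [|i _]; first exact: add_continuous.
apply: cvgM.
- apply: (@continuous_comp _ _ _ F (fun v : 'rV[R]_k => v 0 i)); first exact: cF.
  exact: coord_continuous.
- apply: (@continuous_comp _ _ _ G (fun v : 'rV[R]_k => v 0 i)); first exact: cG.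
  exact: coord_continuous.
Qed.

End Norms.

(** * Compactness and continuity *)

Section Compactness.
Context {R : realType}.

(** The second point [b] need not lie in the compact set, unlike in the usual
form of Heine's theorem.  Halving the local radii leaves room for it. *)
Lemma compact_uniform_continuity (X : pseudoMetricType R)
    (Y : normedModType R) (F : X -> Y) (A : set X) (e : R) :
  compact A -> continuous F -> 0 < e ->
  exists2 d : R, 0 < d & forall a b, A a -> ball a d b -> `|F a - F b| < e.
Proof.
move=> cA cF e0; have e20 : 0 < e / 2 by rewrite divr_gt0.
have /compact_near_coveringP cov := cA.
have H : \forall d \near 0^'+, A `<=` (fun a => forall b, ball a d b -> `|F a - F b| < e).
  apply: (cov R 0^'+ (fun d a => forall b, ball a d b -> `|F a - F b| < e)) => a Aa.
  have /cvgrPdist_lt/(_ _ e20)/nbhs_ballP[r r0 Hr] := cF a.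
  have r20 : 0 < r / 2 by rewrite divr_gt0.
  exists (ball a (r / 2), [set d : R | d < r / 2]).
    by split => /=; [exact: nbhsx_ballx|exact: nbhs_right_lt].
  move=> [a' d] [/= aa' dr] b a'b.
  have aa'r : ball a r a' by apply: le_ball aa'; lra.
  have abr : ball a r b by rewrite [r]splitr; apply: ball_triangle aa' (le_ball _ a'b); exact: ltW.
  move: (Hr _ aa'r) (Hr _ abr) => /= h1 h2.
  rewrite -(subrKA (F a)) (le_lt_trans (ler_normD _ _))// [ltRHS]splitr ltrD//.
  by rewrite distrC.
have [d [d0 Hd]] := filter_ex (filterI (nbhs_right_gt (0:R)) H).
by exists d => // a b Aa; exact: Hd.
Qed.

Lemma compact_norm_le (n : nat) (M : R) : compact [set x : 'rV[R]_n | `|x| <= M].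
Proof.
apply: bounded_closed_compact.
  exists M; split; first exact: num_real.
  by move=> y My x /= xM; exact: le_trans (ltW My).
apply: (@closed_comp _ _ (fun x : 'rV[R]_n => `|x|) [set y | y <= M]).
  by move=> x _; exact: norm_continuous.
exact: closed_le.
Qed.

End Compactness.

(** With [r] the map that replaces a time by its positive part, this extends
continuity from the half-space of nonnegative times to the whole space. *)
Lemma continuous_retract (T U V : topologicalType) (G : U -> V) (A : set U) (r : T -> U) :
  {within A, continuous G} -> continuous r -> (forall t, A (r t)) -> continuous (G \o r).
Proof.
move=> cG cr Ar t; have := cG (r t).
rewrite /continuous_at /= /nbhs /= -(nbhs_subspace_in (Ar t)).
apply: cvg_comp => P /= AP.
have : nbhs t (fun t' => A (r t') -> P (r t')) := cr t _ AP.
rewrite /nbhs /=; apply: filterS => t' /=; apply; exact: Ar.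
Qed.

Lemma continuous_pair (T U V : topologicalType) (g : T -> U) (h : T -> V) :
  continuous g -> continuous h -> continuous (fun t => (g t, h t)).
Proof.
move=> cg ch t.
exact: (@cvg_pair _ _ _ (nbhs t) (nbhs (g t)) (nbhs (h t)) _ _ _ g h (cg t) (ch t)).
Qed.

Lemma continuous_id (T : topologicalType) : continuous (fun t : T => t).
Proof. by move=> t; exact: cvg_id. Qed.

Lemma continuous_cst (T U : topologicalType) (c : U) : continuous (fun _ : T => c).
Proof. by move=> t; exact: cvg_cst. Qed.

Section Clamp.
Context {R : realType} {n m : nat}.

(** Freezing the data at time 0 for negative times makes them continuous
everywhere. *)
Definition clamp {A : Type} (G : R -> A) (t : R) : A := G (Num.max t 0).

Lemma clampE (A : Type) (G : R -> A) t : 0 <= t -> clamp G t = G t.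
Proof. by move=> t0; rewrite /clamp max_l. Qed.

Lemma continuous_clamp3 (V : topologicalType) (G : R -> 'rV[R]_n -> 'rV[R]_m -> V) :
  {within [set p : R * 'rV[R]_n * 'rV[R]_m | 0 <= p.1.1],
     continuous (fun p : R * 'rV[R]_n * 'rV[R]_m => G p.1.1 p.1.2 p.2)} ->
  continuous (fun p : R * 'rV[R]_n * 'rV[R]_m => clamp G p.1.1 p.1.2 p.2).
Proof.
move=> cG.
pose r (p : R * 'rV[R]_n * 'rV[R]_m) := ((Num.max p.1.1 0, p.1.2), p.2).
have c := @continuous_retract _ _ _ _ _ r cG; apply: c.
  have c1 : continuous (fun p : R * 'rV[R]_n * 'rV[R]_m => p.1) by move=> p; exact: cvg_fst.
  apply: continuous_pair; last by move=> p; exact: cvg_snd.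
  apply: continuous_pair => p.
    apply: (@continuous_max _ _ (fun p : R * 'rV[R]_n * 'rV[R]_m => p.1.1) (fun=> 0)).
      by apply: (cvg_comp _ _ (c1 p)); exact: cvg_fst.
    exact: cvg_cst.
  by apply: (cvg_comp _ _ (c1 p)); exact: cvg_snd.
by move=> p /=; rewrite le_max lexx orbT.
Qed.

Lemma continuous_clamp2 (V : topologicalType) (G : R -> 'rV[R]_n -> V) :
  {within [set p : R * 'rV[R]_n | 0 <= p.1],
     continuous (fun p : R * 'rV[R]_n => G p.1 p.2)} ->
  continuous (fun p : R * 'rV[R]_n => clamp G p.1 p.2).
Proof.
move=> cG.
pose r (p : R * 'rV[R]_n) := (Num.max p.1 0, p.2).
have c := @continuous_retract _ _ _ _ _ r cG; apply: c.
  apply: continuous_pair; last by move=> p; exact: cvg_snd.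
  move=> p; apply: (@continuous_max _ _ (fun p : R * 'rV[R]_n => p.1) (fun=> 0)).
    exact: cvg_fst.
  exact: cvg_cst.
by move=> p /=; rewrite le_max lexx orbT.
Qed.

End Clamp.

(** * Proximal subgradients *)

Section ProximalSubgradients.
Context {R : realType} {n : nat}.
Implicit Type Psi : R -> 'rV[R]_n -> R.

(** Only times [t' >= 0] are compared, as in the Dini derivatives, so that the
notion is one-sided at [t = 0]. *)
Definition proximal_subgradient Psi (t : R) (y : 'rV[R]_n)
    (q : R * 'rV[R]_n) : Prop :=
  exists c d : R, 0 < d /\ forall t' y', 0 <= t' -> `|t' - t| < d -> `|y' - y| < d ->
    Psi t y + (t' - t) * q.1 + dot (y' - y) q.2
      - c * ((t' - t) ^+ 2 + `|y' - y| ^+ 2) <= Psi t' y'.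

(** Along [(t + r * u, y + r *: w)] the quadratic term is of order [r ^+ 2]: the
difference quotients lie above a function of [(r, w)] that is continuous up to
[r = 0], where its value at [w = v] is the pairing of [(u, v)] with [q]. *)
Lemma proximal_sub_dini Psi t y q :
  proximal_subgradient Psi t y q -> dini_subgradient Psi t y q.
Proof.
case: q => al xi [c [d [d0 H]]] u v /=; rewrite /lower_dini.
apply/lee_subgt0Pr => e e0; rewrite -EFinB.
pose low (p : R * 'rV[R]_n) : R :=
  u * al + dot p.2 xi - c * (p.1 * (u ^+ 2 + `|p.2| ^+ 2)).
have clow : continuous low.
  move=> p; apply: cvgB.
    apply: cvgD; first exact: cvg_cst.
    apply: (@continuous_dot _ _ _ (fun p : R * 'rV[R]_n => p.2) (fun _ => xi)).
      by move=> ?; exact: cvg_snd.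
    by move=> ?; exact: cvg_cst.
  apply: cvgM; first exact: cvg_cst.
  apply: cvgM; first exact: cvg_fst.
  apply: cvgD; first exact: cvg_cst.
  apply: (@continuous_comp _ _ _ (fun p : R * 'rV[R]_n => `|p.2|) (fun x => x ^+ 2)).
    by apply: cvg_norm; exact: cvg_snd.
  exact: exprn_continuous.
have low0 : low (0, v) = u * al + dot v xi by rewrite /low /= mul0r mulr0 subr0.
have c1 : continuous (fun p : R * 'rV[R]_n => `|p.1 * u|).
  move=> p; apply: cvg_norm; apply: cvgM; last exact: cvg_cst.
  exact: cvg_fst.
have c2 : continuous (fun p : R * 'rV[R]_n => `|p.1 *: p.2|).
  by move=> p; apply: cvg_norm; apply: cvgZ; [exact: cvg_fst|exact: cvg_snd].
have N1 : \forall p \near (0 : R, v), u * al + dot v xi - e < low p.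
  apply: (cvgr_gt _ (clow (0, v))).
  by rewrite low0 ltrBlDr ltrDl.
have N2 : \forall p \near (0 : R, v), `|p.1 * u| < d.
  by apply: (cvgr_lt _ (c1 (0, v))); rewrite /= mul0r normr0.
have N3 : \forall p \near (0 : R, v), `|p.1 *: p.2| < d.
  by apply: (cvgr_lt _ (c2 (0, v))); rewrite /= scale0r normr0.
have [[B1 B2] /= [B10 B2v] HB] := filterI N1 (filterI N2 N3).
rewrite limf_einfE; apply: le_ereal_sup_tmp.
pose A := [set p : R * 'rV[R]_n | [/\ 0 <= t + p.1 * u, 0 < p.1, B1 p.1 & B2 p.2]].
exists (ereal_inf (dini_quotient Psi t y u @` A)).
  exists A => //; rewrite /dini_filter /within /=.
  exists ([set r | 0 < r /\ B1 r], B2) => /=.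
    split => //; apply: filterI; first exact: nbhs_right_gt.
    exact: (@cvg_within _ (nbhs (0:R))).
  by move=> [r w] /= [[r0 Br] Bw] Hr; split.
apply: le_ereal_inf_tmp => _ [[r w] [/= tr r0 Br Bw] <-].
have [/= h1 [h2 h3]] := HB (r, w) (conj Br Bw).
rewrite /dini_quotient lee_fin /= ler_pdivlMr// (le_trans (ltW (_ : _ < low (r, w) * r)))//.
  by rewrite ltr_pM2r.
have := H (t + r * u) (y + r *: w) tr.
rewrite !(addrC t) !(addrC y) !addrK => /(_ h2 h3).
rewrite dotZl normrZ (gtr0_norm r0) /low /= -lerBrDl => ?; nra.
Qed.

Lemma proximal_super_dini (Phi : R -> 'rV[R]_n -> R) t y q :
  proximal_subgradient (fun t x => - Phi t x) t y q ->
  dini_supergradient Phi t y (- q.1, - q.2).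
Proof.
move=> /proximal_sub_dini H u v; have := H u v.
rewrite /= /lower_dini /upper_dini dotNr mulrN -opprD EFinN.
rewrite (_ : dini_quotient _ t y u = (\- dini_quotient Phi t y u)%E).
  by rewrite limf_einfN leeNr.
apply/funext => p /=; rewrite /dini_quotient /=; congr EFin.
by rewrite -mulNr opprB opprK addrC.
Qed.

End ProximalSubgradients.

(** * Inf-convolution *)

Section InfConvolution.
Context {R : realType} {n : nat}.
Variable Psi : R -> 'rV[R]_n -> R.
Hypothesis cPsi : continuous (fun p : R * 'rV[R]_n => Psi p.1 p.2).
Implicit Types (p q : R * 'rV[R]_n) (a b t : R) (x y : 'rV[R]_n).

(** Times and states have separate weights, because the weight of times has to
be chosen in terms of that of states. *)
Definition penalty a b p q : R :=
  a * (p.1 - q.1) ^+ 2 + b * dot (p.2 - q.2) (p.2 - q.2).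

Definition penalty_slope a b p q : R * 'rV[R]_n :=
  (2 * a * (p.1 - q.1), (2 * b) *: (p.2 - q.2)).

(** The penalty is quadratic, so its first-order expansion is exact up to the
penalty of the displacement. *)
Lemma penalty_addl a b p q h D :
  penalty a b (p.1 + h, p.2 + D) q =
  penalty a b p q + h * (penalty_slope a b p q).1
    + dot D (penalty_slope a b p q).2 + (a * h ^+ 2 + b * dot D D).
Proof.
rewrite /penalty /penalty_slope /= dotZr addrAC (addrAC p.1) !(dotDl, dotDr) !(dotC _ D).
ring.
Qed.

Lemma penalty_addr a b p q h D :
  penalty a b p (q.1 + h, q.2 + D) =
  penalty a b p q - h * (penalty_slope a b p q).1
    - dot D (penalty_slope a b p q).2 + (a * h ^+ 2 + b * dot D D).
Proof.
have := penalty_addl a b p q (- h) (- D).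
rewrite dotNl dotNl dotNr opprK sqrrN mulNr => <-.
by rewrite /penalty /= !opprD !addrA !(addrAC _ (- h)) !(addrAC _ (- D)).
Qed.

Definition slab T M : set (R * 'rV[R]_n) :=
  [set` `[0, T]] `*` [set x | `|x| <= M].

Lemma compact_slab T M : compact (slab T M).
Proof. by apply: compact_setX; [exact: segment_compact|exact: compact_norm_le]. Qed.

Lemma continuous_penalized a b p :
  continuous (fun q => Psi q.1 q.2 + penalty a b p q).
Proof.
move=> q; apply: cvgD; first exact: cPsi.
have c1 : continuous (fun q => p.1 - q.1).
  by move=> q'; apply: cvgB; [exact: cvg_cst|exact: cvg_fst].
have c2 : continuous (fun q => p.2 - q.2).
  by move=> q'; apply: cvgB; [exact: cvg_cst|exact: cvg_snd].
apply: cvgD; apply: cvgM; [exact: cvg_cst| |exact: cvg_cst|].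
  under eq_fun do rewrite expr2.
  by rewrite expr2; apply: cvgM; exact: c1.
exact: (continuous_dot c2 c2).
Qed.

Lemma penalized_minimizer a b (T M : R) p : 0 <= T -> 0 <= M ->
  exists q, slab T M q /\ forall q', slab T M q' ->
    Psi q.1 q.2 + penalty a b p q <= Psi q'.1 q'.2 + penalty a b p q'.
Proof.
move=> T0 M0.
have D0 : slab T M !=set0 by exists (0, 0); split; rewrite /= ?in_itv/= ?lexx ?normr0.
have [|q qD qmin] := compact_EVT_min D0 (@compact_slab T M)
   (f := fun q => Psi q.1 q.2 + penalty a b p q).
  by apply: continuous_subspaceT; exact: continuous_penalized.
by exists q; split=> [|q' q'D]; [exact: set_mem|apply: qmin; exact: mem_set].
Qed.

(** Near an interior minimizer, minimality bounds the decrease of [Psi] by the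
increase of the penalty, which is linear up to a square. *)
Lemma minimizer_proximal a b T M p q : 0 <= b ->
  slab T M q -> q.1 < T -> `|q.2| < M ->
  (forall q', slab T M q' ->
    Psi q.1 q.2 + penalty a b p q <= Psi q'.1 q'.2 + penalty a b p q') ->
  proximal_subgradient Psi q.1 q.2 (penalty_slope a b p q).
Proof.
move=> b0 [/=]; rewrite in_itv/= => /andP[q0 _] _ qT qM Hmin.
exists (`|a| + b * n%:R), (Num.min (T - q.1) (M - `|q.2|)).
split; first by rewrite lt_min !subr_gt0 qT.
move=> t y t0; rewrite !lt_min => /andP[tT _] /andP[_ yM].
have /Hmin : slab T M (t, y).
  split => /=; first by rewrite in_itv/= t0 /=; have := ler_norm (t - q.1); lra.
  by have := ler_normD (y - q.2) q.2; rewrite subrK; lra.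
have := penalty_addr a b p q (t - q.1) (y - q.2).
rewrite (addrC q.1) (addrC q.2) !subrK => ->.
have h1 : a * (t - q.1) ^+ 2 <= `|a| * (t - q.1) ^+ 2.
  by rewrite ler_wpM2r ?sqr_ge0 ?ler_norm.
have h2 : b * dot (y - q.2) (y - q.2) <= b * (n%:R * `|y - q.2| ^+ 2).
  by rewrite ler_wpM2l// expr2 (le_trans (ler_norm _))// norm_dot.
have h3 : 0 <= b * n%:R * (t - q.1) ^+ 2 by rewrite mulr_ge0 ?sqr_ge0// mulr_ge0.
have h4 : 0 <= `|a| * `|y - q.2| ^+ 2 by rewrite mulr_ge0 ?sqr_ge0.
move: (penalty_slope a b p q) => sl; nra.
Qed.

(** Comparing the minimizer [q] with [p] itself bounds the penalty by the
decrease of [Psi] from [p] to [q].  First this decrease is at most [2 * B],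
which by the choice of the weights forces [q] close to [p]; then uniform
continuity makes the decrease, hence the penalty, smaller than [e]. *)
Lemma minimizer_near (a b T M B r s e : R) p q : 0 < a -> 0 < b -> 0 < r -> 0 < s ->
  s <= r -> b * r ^+ 2 = 2 * B + 1 -> a * s ^+ 2 = 2 * B + 1 ->
  slab T M p -> slab (T + 1) (M + 1) p -> slab (T + 1) (M + 1) q ->
  (forall q, slab (T + 1) (M + 1) q -> `|Psi q.1 q.2| < B) ->
  (forall p q, slab T M p -> ball p r q -> `|Psi p.1 p.2 - Psi q.1 q.2| < e) ->
  (forall q', slab (T + 1) (M + 1) q' ->
    Psi q.1 q.2 + penalty a b p q <= Psi q'.1 q'.2 + penalty a b p q') ->
  [/\ `|p.1 - q.1| < s, `|p.2 - q.2| < r, penalty a b p q <= e &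
      `|Psi q.1 q.2 + penalty a b p q - Psi p.1 p.2| <= e].
Proof.
move=> a0 b0 r0 s0 sr bE aE pT pD qD HB Hr qmin.
have := qmin _ pD; rewrite {2}/penalty !subrr expr0n /= mulr0 add0r.
rewrite /dot big1 ?mulr0; last by move=> i _; rewrite mxE mul0r.
rewrite addr0 => Hpen.
have p1 : 0 <= a * (p.1 - q.1) ^+ 2 by rewrite mulr_ge0 ?sqr_ge0 ?(ltW a0).
have p2 : 0 <= b * dot (p.2 - q.2) (p.2 - q.2) by rewrite mulr_ge0 ?dotxx_ge0 ?(ltW b0).
have HpB : penalty a b p q < 2 * B + 1.
  have /ltr_normlP[B1 _] := HB _ qD; have /ltr_normlP[_ B4] := HB _ pD.
  by move: B1 B4 Hpen; clear; lra.
have ts : `|p.1 - q.1| < s.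
  rewrite -(@ltr_pXn2r _ 2) ?nnegrE ?(ltW s0)// real_normK ?num_real//.
  rewrite -(ltr_pM2l a0) aE; move: HpB p2; rewrite /penalty; clear; lra.
have xr : `|p.2 - q.2| < r.
  rewrite -(@ltr_pXn2r _ 2) ?nnegrE ?(ltW r0)//.
  apply: (le_lt_trans (sqr_norm_le_dot _)).
  rewrite -(ltr_pM2l b0) bE; move: HpB p1; rewrite /penalty; clear; lra.
have /ltr_normlP[h1 h2] : `|Psi p.1 p.2 - Psi q.1 q.2| < e.
  apply: Hr => //; split => /=; rewrite -ball_normE /ball_ //=.
  exact: lt_le_trans sr.
have pen0 : 0 <= penalty a b p q by exact: addr_ge0.
split => //; first by move: Hpen h2; clear; lra.
by rewrite ler_norml; apply/andP; split; move: Hpen h2 pen0; clear; lra.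
Qed.

End InfConvolution.

(** Here [v] is the displacement to a minimizer, [2 * b *: v] the slope and [d] a
change of velocity.  The slope is not small, but its product with the part of
[d] proportional to [v] is controlled by the penalty [b * `|v| ^+ 2]. *)
Lemma norm_dot_slope_le (R : realType) (n : nat) (d v : 'rV[R]_n) (b K w e : R) :
  0 <= b -> 0 <= K -> 0 <= w -> `|v| <= 1 -> b * `|v| ^+ 2 <= e ->
  `|d| <= K * `|v| + 2 * w ->
  `|dot d ((2 * b) *: v)| <= 2 * (n%:R * K) * e + 4 * (n%:R * b) * w.
Proof.
move=> b0 K0 w0 v1 ve dv; have N0 : 0 <= n%:R :> R by [].
rewrite (le_trans (norm_dot _ _))// normrZ.
have b20 : 0 <= 2 * b by rewrite mulr_ge0.
rewrite (ger0_norm b20).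
apply: (@le_trans _ _ (n%:R * ((K * `|v| + 2 * w) * (2 * b * `|v|)))).
  by rewrite ler_wpM2l// ler_wpM2r// mulr_ge0.
have y1 : 2 * (n%:R * K) * (b * `|v| ^+ 2) <= 2 * (n%:R * K) * e.
  by rewrite ler_wpM2l// !mulr_ge0.
have y2 : 4 * (n%:R * b) * w * `|v| <= 4 * (n%:R * b) * w * 1.
  by rewrite ler_wpM2l// !mulr_ge0.
rewrite (_ : _ * _ = 2 * (n%:R * K) * (b * `|v| ^+ 2) + 4 * (n%:R * b) * w * `|v|); last ring.
by rewrite lerD// (le_trans y2)// mulr1.
Qed.

Section Regularization.
Context {R : realType} {n m : nat}.
Variable Psi : R -> 'rV[R]_n -> R.
Hypothesis cPsi : continuous (fun p : R * 'rV[R]_n => Psi p.1 p.2).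
Variables (f : R -> 'rV[R]_n -> 'rV[R]_m -> 'rV[R]_n)
          (g : R -> 'rV[R]_n -> 'rV[R]_m -> R) (Omega : set 'rV[R]_m) (K : R).
Hypothesis cf : continuous (fun p : R * 'rV[R]_n * 'rV[R]_m => f p.1.1 p.1.2 p.2).
Hypothesis cg : continuous (fun p : R * 'rV[R]_n * 'rV[R]_m => g p.1.1 p.1.2 p.2).
Hypothesis cO : compact Omega.
Hypothesis K0 : 0 <= K.
Hypothesis lipf : forall (t : R) v x z, 0 <= t -> Omega v ->
  `|f t x v - f t z v| <= K * `|x - z|.

(** [Th] is the inf-convolution of [Psi] on a slab slightly larger than the one
considered, so that the minimizers are interior.  The constants are chosen in
the order [e1] (size of the penalties), [b] (weight of states), [w]
(oscillation of [f], small compared with [1 / b]), [a] (weight of times), [h0]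
(length of the steps, small compared with [1 / a] and [1 / b]). *)
Lemma inf_convolution (T M L e : R) : 0 <= T -> 0 <= M -> 0 <= L -> 0 < e ->
  exists (Th : R -> 'rV[R]_n -> R) (h0 : R), [/\ 0 < h0,
    forall t x, 0 <= t <= T -> `|x| <= M -> `|Th t x - Psi t x| <= e &
    forall t x, 0 <= t <= T -> `|x| <= M -> exists t' y q,
      [/\ 0 <= t', proximal_subgradient Psi t' y q,
        forall h D, 0 <= h <= h0 -> `|D| <= L * h ->
          Th (t + h) (x + D) <= Th t x + h * q.1 + dot D q.2 + e * h &
        forall r x' v, t <= r <= t + h0 -> `|x' - x| <= L * h0 -> Omega v ->
          `|dot (f t' y v - f r x' v) q.2| <= e /\
          `|g t' y v - g r x' v| <= e]].
Proof.
move=> T0 M0 L0 e0; pose N : R := n%:R.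
have N0 : 0 <= N by [].
have T10 : 0 <= T + 1 by lra.
have M10 : 0 <= M + 1 by lra.
have NK0 : 0 <= N * K by exact: mulr_ge0.
pose e1 := e / (4 * (N * K) + 1).
have e10 : 0 < e1 by rewrite divr_gt0//; lra.
have e1E : 4 * (N * K) * e1 + e1 = e.
  by rewrite /e1; field; apply/lt0r_neq0; lra.
clearbody e1.
have [B B0 HB] : exists2 B : R, 0 < B & forall q : R * 'rV[R]_n,
    slab (T + 1) (M + 1) q -> `|Psi q.1 q.2| < B.
  have := compact_bounded (continuous_compact (continuous_subspaceT cPsi)
    (@compact_slab _ n (T + 1) (M + 1))).
  by move=> /ex_strict_bound_gt0[B B0 HB]; exists B => // q qD; apply: HB; exists q.
have [r1 r10 Hr1] := compact_uniform_continuity (@compact_slab _ n T M) cPsi e10.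
have e20 : 0 < e / 2 by lra.
have cA := compact_setX (@compact_slab _ n T M) cO.
have [r2 r20 Hr2] := compact_uniform_continuity cA cg e20.
pose r := Num.min r1 (Num.min r2 1).
have r0 : 0 < r by rewrite !lt_min r10 r20 /=.
have rr0 : r <= r1 by rewrite /r ge_min lexx.
have rr1 : r <= 1 by rewrite /r !ge_min lexx !orbT.
have rr2 : r <= r2 by rewrite /r !ge_min lexx !orbT.
clearbody r.
pose b := (2 * B + 1) / r ^+ 2.
have b0 : 0 < b by rewrite divr_gt0 ?exprn_gt0//; lra.
have bE : b * r ^+ 2 = 2 * B + 1 by rewrite divfK// lt0r_neq0 ?exprn_gt0.
clearbody b.
have Nb0 : 0 <= N * b by rewrite mulr_ge0// ltW.
pose w := e / (8 * (N * b) + 1).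
have w0 : 0 < w by rewrite divr_gt0//; lra.
have wE : 8 * (N * b) * w + w = e.
  by rewrite /w; field; apply/lt0r_neq0; lra.
clearbody w.
have [r3 r30 Hr3] := compact_uniform_continuity cA cf w0.
pose s := Num.min r r3.
have s0 : 0 < s by rewrite lt_min r0.
have sr : s <= r by rewrite /s ge_min lexx.
have sr3 : s <= r3 by rewrite /s ge_min lexx orbT.
clearbody s.
pose a := (2 * B + 1) / s ^+ 2.
have a0 : 0 < a by rewrite divr_gt0 ?exprn_gt0//; lra.
have aE : a * s ^+ 2 = 2 * B + 1 by rewrite divfK// lt0r_neq0 ?exprn_gt0.
clearbody a.
have L20 : 0 <= b * N * L ^+ 2 by rewrite mulr_ge0 ?sqr_ge0// mulr_ge0// ltW.
pose h0 := Num.min (e / (a + b * N * L ^+ 2)) (s / (L + 1) / 2).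
have h00 : 0 < h0.
  by rewrite lt_min !divr_gt0//; lra.
have h0e : h0 * (a + b * N * L ^+ 2) <= e.
  by rewrite -ler_pdivlMr; [rewrite /h0 ge_min lexx|lra].
have h0s' : h0 * (2 * (L + 1)) <= s.
  rewrite -ler_pdivlMr; last lra.
  rewrite (_ : s / _ = s / (L + 1) / 2); first by rewrite /h0 ge_min lexx orbT.
  by field; rewrite lt0r_neq0//; lra.
clearbody h0.
have Lh0 : 0 <= L * h0 by rewrite mulr_ge0// ltW.
have h0s : h0 < s by lra.
have Lh0s : L * h0 < s by lra.
have [minz Hminz] := choice (fun p => @penalized_minimizer R n Psi cPsi a b _ _ p T10 M10).
pose Th t x := Psi (minz (t, x)).1 (minz (t, x)).2 + penalty a b (t, x) (minz (t, x)).
have e1e : e1 <= e.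
  by rewrite -e1E lerDr mulr_ge0 ?(ltW e10)// mulr_ge0.
have key (t : R) (x : 'rV[R]_n) : 0 <= t <= T -> `|x| <= M ->
  let q := minz (t, x) in
  [/\ slab (T + 1) (M + 1) q, `|t - q.1| < s, `|x - q.2| < r,
      penalty a b (t, x) q <= e1 & `|Th t x - Psi t x| <= e].
  move=> tT xM q; have [qD qmin] := Hminz (t, x).
  have pD : slab (T + 1) (M + 1) (t, x).
    split; rewrite /= ?in_itv /=; last by rewrite (le_trans xM)// lerDl.
    by move/andP: tT => [-> tT]; rewrite (le_trans tT)// lerDl.
  have pT : slab T M (t, x) by split; rewrite /= ?in_itv.
  have Hr p' q' : slab T M p' -> ball p' r q' -> `|Psi p'.1 p'.2 - Psi q'.1 q'.2| < e1.
    by move=> p'T p'q'; apply: Hr1 => //; exact: le_ball rr0 _ p'q'.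
  have [h1 h2 h3 h4] := minimizer_near a0 b0 r0 s0 sr bE aE pT pD qD HB Hr qmin.
  by split => //; exact: le_trans h4 e1e.
exists Th, h0; split => // t x tT xM; first by case: (key t x tT xM).
have [qD ts xr pe _] := key t x tT xM; have [_ qmin] := Hminz (t, x).
clear key; have ThE : Th t x = Psi (minz (t, x)).1 (minz (t, x)).2 +
  penalty a b (t, x) (minz (t, x)) by [].
set q := minz (t, x) in qD ts xr pe qmin ThE.
have q0 : 0 <= q.1 by case: qD => /=; rewrite in_itv/= => /andP[].
exists q.1, q.2, (penalty_slope a b (t, x) q); split.
- exact: q0.
- apply: (minimizer_proximal (ltW b0) qD) => //.
    move: ts tT; rewrite ltr_norml => /andP[h1 _] /andP[_ h5].
    by have := le_trans sr rr1; lra.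
  have := ler_normD (q.2 - x) x; rewrite subrK (distrC q.2).
  by lra.
- move=> h D /andP[h1 h2] DL.
  (* The minimizer for [(t, x)] competes for [(t + h, x + D)]. *)
  have [_ /(_ q qD) hm] := Hminz (t + h, x + D).
  apply: (le_trans hm); rewrite (penalty_addl a b (t, x)) ThE.
  have d1 : b * dot D D <= b * (N * (L * h) ^+ 2).
    rewrite ler_wpM2l ?(ltW b0)// (le_trans (ler_norm _))// (le_trans (norm_dot _ _))//.
    by rewrite ler_wpM2l// -expr2 ler_pXn2r ?nnegrE// mulr_ge0.
  have d2 : h * (a + b * N * L ^+ 2) * h <= e * h.
    rewrite ler_wpM2r// (le_trans _ h0e)// ler_wpM2r//.
    by rewrite addr_ge0// ltW.
  rewrite (_ : h * (a + b * N * L ^+ 2) * h = a * h ^+ 2 + b * (N * (L * h) ^+ 2)) in d2; last ring.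
  by rewrite !addrA -(addrA _ (a * _)) lerD2l (le_trans _ d2)// lerD2l.
move=> r' x' v /andP[r'1 r'2] x'x Ov.
have AO : (slab T M `*` Omega) (t, x, v) by split.
have near_q d : s <= d -> r <= d -> ball (t, x, v) d (q.1, q.2, v).
  move=> sd rd; split; last exact: ballxx (lt_le_trans s0 sd).
  by split => /=; rewrite -ball_normE /ball_ /=; [exact: lt_le_trans sd|exact: lt_le_trans rd].
have near_r d : s <= d -> ball (t, x, v) d (r', x', v).
  move=> sd; split; last exact: ballxx (lt_le_trans s0 sd).
  split => /=; rewrite -ball_normE /ball_ /=.
    rewrite distrC ger0_norm ?subr_ge0// (lt_le_trans _ sd)//.
    by apply: le_lt_trans h0s; rewrite lerBlDl.
  by rewrite distrC; apply: (le_lt_trans x'x); exact: lt_le_trans sd.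
split.
  (* [f t' y v] is reached from [f r' x' v] through the point [x] at the times
     [t] and [t']: only the last change is Lipschitz in the displacement. *)
  have /= f1 := Hr3 _ _ AO (near_r _ sr3).
  have /= f2 : `|f t x v - f q.1 x v| < w.
    apply: (Hr3 (t, x, v) (q.1, x, v)) => //.
    split; last exact: ballxx.
    split => /=; last exact: ballxx.
    by rewrite -ball_normE /ball_ /=; exact: lt_le_trans sr3.
  have f3 := lipf x q.2 q0 Ov.
  have f4 : `|f q.1 q.2 v - f r' x' v| <= K * `|x - q.2| + 2 * w.
    rewrite (_ : _ - _ = (f t x v - f r' x' v) - (f t x v - f q.1 x v) - (f q.1 x v - f q.1 q.2 v)); last first.
      by apply/matrixP => i j; rewrite !mxE; ring.
    have := ler_normB ((f t x v - f r' x' v) - (f t x v - f q.1 x v)) (f q.1 x v - f q.1 q.2 v).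
    have := ler_normB (f t x v - f r' x' v) (f t x v - f q.1 x v).
    lra.
  have z1 : b * `|x - q.2| ^+ 2 <= e1.
    apply: le_trans pe; rewrite /penalty /= -[leLHS]add0r lerD//.
      by rewrite mulr_ge0 ?sqr_ge0 ?(ltW a0).
    by rewrite ler_wpM2l ?(ltW b0)// sqr_norm_le_dot.
  have z2 : `|x - q.2| <= 1 by exact: ltW (lt_le_trans xr rr1).
  have := norm_dot_slope_le (ltW b0) K0 (ltW w0) z2 z1 f4; rewrite -/N.
  lra.
have /= g1 := Hr2 _ _ AO (near_r _ (le_trans sr rr2)).
have /= g2 := Hr2 _ _ AO (near_q _ (le_trans sr rr2) rr2).
rewrite (_ : _ - _ = (g t x v - g r' x' v) - (g t x v - g q.1 q.2 v)); last ring.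
rewrite (le_trans (ler_normB _ _))//.
by rewrite [leRHS]splitr lerD// ltW.
Qed.

End Regularization.

(** * Lebesgue integrals on intervals *)

Lemma Rintegral_sum (R : realType) (I : Type) (r : seq I) (h : I -> R -> R)
    (D : set R) :
  measurable (D : set (measurableTypeR R)) ->
  (forall i, (@lebesgue_measure R).-integrable D (EFin \o h i)) ->
  (@lebesgue_measure R).-integrable D (EFin \o (fun t => \sum_(i <- r) h i t)) /\
  \int[@lebesgue_measure R]_(t in D) (\sum_(i <- r) h i t) =
  \sum_(i <- r) \int[@lebesgue_measure R]_(t in D) h i t.
Proof.
move=> mD ih; elim: r => [|i r [IH1 IH2]].
  rewrite big_nil; have E : (fun t : R => \sum_(i <- [::]) h i t) = fun=> 0.
    by apply/funext => t; rewrite big_nil.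
  split; first by rewrite E; exact: integrable0.
  by rewrite E Rintegral_cst// mul0r.
have E : (fun t => \sum_(j <- i :: r) h j t) = (fun t => h i t + \sum_(j <- r) h j t).
  by apply/funext => t; rewrite big_cons.
split.
  rewrite E (_ : EFin \o _ =
    fun t => ((EFin \o h i) t + (EFin \o (fun t => (\sum_(j <- r) h j t)%R)) t)%E).
    exact: integrableD.
  by apply/funext.
by rewrite E RintegralD// big_cons IH2.
Qed.

Section Integration.
Context {R : realType}.
Local Notation mu := (@lebesgue_measure R).
Implicit Types (D : set R) (h : R -> R) (a b c : R).

Lemma integrable_ae_dominated D h (G : R -> R) : measurable (D : set (measurableTypeR R)) ->
  measurable_fun (D : set (measurableTypeR R)) h -> mu.-integrable D (EFin \o G) ->
  {ae mu, forall t, D t -> `|h t| <= G t} -> mu.-integrable D (EFin \o h).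
Proof.
move=> mD mh iG [N [mN N0 HN]].
have mhE : measurable_fun D (EFin \o h) by exact/measurable_EFinP.
apply: (negligible_integrable mN mD mhE N0).2.
apply: (le_integrable (measurableD mD mN) (g := EFin \o G)).
- by apply: measurable_funS mhE => // x [].
- move=> t [Dt Nt] /=; rewrite lee_fin.
  have : D t -> `|h t| <= G t by apply: contrapT => /HN.
  by move=> /(_ Dt) /le_trans; apply; exact: ler_norm.
- by apply: integrableS iG => //; exact: measurableD.
Qed.

Lemma le_Rintegral_ae D h1 h2 : measurable (D : set (measurableTypeR R)) ->
  mu.-integrable D (EFin \o h1) -> mu.-integrable D (EFin \o h2) ->
  {ae mu, forall t, D t -> h1 t <= h2 t} ->
  \int[mu]_(t in D) h1 t <= \int[mu]_(t in D) h2 t.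
Proof.
move=> mD i1 i2 le12; rewrite -subr_ge0 -RintegralB//.
have iB : mu.-integrable D (EFin \o (fun t => h2 t - h1 t)).
  rewrite (_ : _ \o _ = (EFin \o h2) \- (EFin \o h1))%E; first exact: integrableB.
  by apply/funext.
suff -> : \int[mu]_(t in D) (h2 t - h1 t) = \int[mu]_(t in D) `|h2 t - h1 t|.
  exact: Rintegral_ge0.
congr fine; apply: ae_eq_integral => //.
- exact: measurable_int iB.
- exact: measurable_int (integrable_norm iB).
- case: le12 => N [mN N0 HN]; exists N; split => // t /= Ht; apply: HN => /= H.
  by apply: Ht => Dt; rewrite ger0_norm// subr_ge0 H.
Qed.

Lemma Rintegral_cst_itv a b k : a <= b -> \int[mu]_(_ in `[a, b]) k = k * (b - a).
Proof.
move=> ab; rewrite Rintegral_cst//= lebesgue_measure_itv/= lte_fin.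
case: ltP => // ba; first by rewrite (_ : a = b) ?subrr//; apply/eqP; rewrite eq_le ab.
Qed.

Lemma integrable_cst_itv a b k : mu.-integrable `[a, b] (EFin \o (fun=> k)).
Proof.
apply: measurable_bounded_integrable => //.
  by rewrite /= lebesgue_measure_itv/=; case: ifP => // _; rewrite -EFinB ltry.
exists `|k|; split; first exact: num_real.
by move=> y ky x _; exact: ltW.
Qed.

Lemma integrable_sub_itv (i j : interval R) h : (j <= i)%O ->
  mu.-integrable [set` i] (EFin \o h) -> mu.-integrable [set` j] (EFin \o h).
Proof. by move=> ji; apply: integrableS => //; exact: (subitvP ji). Qed.

Lemma Rintegral_itv_split a b (c : itv_bound R) h : a <= b -> (BRight b <= c)%O ->
  mu.-integrable [set` Interval (BLeft a) c] (EFin \o h) ->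
  \int[mu]_(t in [set` Interval (BLeft a) c]) h t =
  \int[mu]_(t in `[a, b]) h t + \int[mu]_(t in [set` Interval (BLeft b) c]) h t.
Proof.
move=> ab bc ih; have := @Rintegral_itvB R h (BLeft a) c b ih.
rewrite bnd_simp => /(_ ab bc) /eqP; rewrite subr_eq addrC => /eqP ->.
congr (_ + _); rewrite Rintegral_itv_obnd_cbnd//.
apply: integrable_sub_itv ih; rewrite /Order.le/= lexx andbT bnd_simp.
exact: ab.
Qed.

Definition splice {A : Type} b (h1 h2 : R -> A) (t : R) : A :=
  if t <= b then h1 t else h2 t.

Lemma measurable_splice a b (c : itv_bound R) h1 h2 : a <= b -> (BRight b <= c)%O ->
  measurable_fun (`[a, b] : set R) h1 ->
  measurable_fun ([set` Interval (BLeft b) c] : set R) h2 ->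
  measurable_fun ([set` Interval (BLeft a) c] : set R) (splice b h1 h2).
Proof.
move=> ab bc m1 m2.
rewrite (_ : [set` Interval (BLeft a) c] = `[a, b]%classic `|` [set` Interval (BRight b) c]); last first.
  by rewrite -itv_bndbnd_setU// bnd_simp.
apply/measurable_funU => //; split.
  apply: eq_measurable_fun m1 => t; rewrite inE /= in_itv/= => /andP[_ tb].
  by rewrite /splice tb.
have : measurable_fun [set` Interval (BRight b) c] h2.
  by apply: measurable_funS m2 => //; apply: subset_itvr; rewrite bnd_simp.
apply: eq_measurable_fun => t; rewrite inE /= in_itv/= => /andP[bt _].
by rewrite /splice leNgt bt.
Qed.

Lemma integrable_splice a b (c : itv_bound R) h1 h2 : a <= b -> (BRight b <= c)%O ->
  mu.-integrable `[a, b] (EFin \o h1) ->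
  mu.-integrable [set` Interval (BLeft b) c] (EFin \o h2) ->
  mu.-integrable [set` Interval (BLeft a) c] (EFin \o splice b h1 h2).
Proof.
move=> ab bc i1 i2; apply/integrableP; split.
  apply/measurable_EFinP; apply: measurable_splice => //.
    by apply/measurable_EFinP; exact: measurable_int i1.
  by apply/measurable_EFinP; exact: measurable_int i2.
have E1 : {in `[a, b], EFin \o h1 =1 EFin \o splice b h1 h2}.
  by move=> t; rewrite in_itv/= => /andP[_ tb]; rewrite /splice /= tb.
have E2 : {in Interval (BRight b) c, EFin \o h2 =1 EFin \o splice b h1 h2}.
  by move=> t; rewrite in_itv/= => /andP[bt _]; rewrite /splice /= leNgt bt.
have j1 : mu.-integrable `[a, b] (EFin \o splice b h1 h2).
  by apply: eq_integrable i1 => // t; rewrite inE; exact: E1.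
have j2 : mu.-integrable [set` Interval (BRight b) c] (EFin \o splice b h1 h2).
  apply: (@eq_integrable _ _ _ mu _ _ (EFin \o h2)) => //.
    by move=> t; rewrite inE; exact: E2.
  by apply: integrableS i2 => //; apply: subset_itvr; rewrite bnd_simp.
rewrite (@itv_bndbnd_setU _ _ _ (BRight b)) ?bnd_simp//.
rewrite ge0_integral_setU//.
- by apply: lte_add_pinfty; [case/integrableP: j1|case/integrableP: j2].
- apply/measurable_funU => //; split.
    by case/integrableP: j1 => mj _; exact: (measurableT_comp _ mj).
  by case/integrableP: j2 => mj _; exact: (measurableT_comp _ mj).
- rewrite disj_set2E; apply/eqP/seteqP; split => // t [] /=.
  by rewrite !in_itv/= => /andP[_ tb] /andP[bt _]; move: bt; rewrite ltNge tb.
Qed.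

Lemma Rintegral_splice_le a b h1 h2 t : t <= b ->
  \int[mu]_(r in `[a, t]) splice b h1 h2 r = \int[mu]_(r in `[a, t]) h1 r.
Proof.
move=> tb; apply: eq_Rintegral => r; rewrite inE /= in_itv/= => /andP[_ rt].
by rewrite /splice (le_trans rt tb).
Qed.

Lemma Rintegral_splice_ge a b (c : itv_bound R) h1 h2 : a <= b -> (BRight b <= c)%O ->
  mu.-integrable `[a, b] (EFin \o h1) ->
  mu.-integrable [set` Interval (BLeft b) c] (EFin \o h2) ->
  \int[mu]_(r in [set` Interval (BLeft a) c]) splice b h1 h2 r =
  \int[mu]_(r in `[a, b]) h1 r + \int[mu]_(r in [set` Interval (BLeft b) c]) h2 r.
Proof.
move=> ab bc i1 i2; have ig := integrable_splice ab bc i1 i2.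
rewrite (Rintegral_itv_split ab bc ig) Rintegral_splice_le//; congr (_ + _).
have sub : [set` Interval (BRight b) c] `<=` [set` Interval (BLeft b) c].
  by apply: subset_itvr; rewrite bnd_simp.
rewrite -!Rintegral_itv_obnd_cbnd.
- apply: eq_Rintegral => r; rewrite inE /= in_itv/= => /andP[br _].
  by rewrite /splice leNgt br.
- by apply: integrableS i2.
- apply: integrableS ig => //; apply: (subset_trans sub).
  by apply: subset_itvr; rewrite bnd_simp.
Qed.

Lemma norm_Rintegral_le_ae D h (G : R -> R) : measurable (D : set (measurableTypeR R)) ->
  measurable_fun (D : set (measurableTypeR R)) h -> mu.-integrable D (EFin \o G) ->
  {ae mu, forall t, D t -> `|h t| <= G t} ->
  `|\int[mu]_(t in D) h t| <= \int[mu]_(t in D) G t.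
Proof.
move=> mD mh iG hG; have ih := integrable_ae_dominated mD mh iG hG.
rewrite (le_trans (le_normr_Rintegral mD ih))// le_Rintegral_ae//.
exact: (integrable_norm ih).
Qed.

Lemma is_derive_expRM (k c t : R) :
  is_derive t 1 (fun t => k * expR (c * t)) (k * (c * expR (c * t))).
Proof.
apply: DeriveDef; first by apply: ex_derive.
rewrite -derive1E derive1Ml// derive1_comp// derive1Ml// derive1_id mulr1 derive1E.
by rewrite derive_val; congr (_ * _); rewrite mulrC.
Qed.

Lemma expR_discount (delta T : R) : 0 < delta ->
  mu.-integrable `[T, +oo[ (EFin \o (fun t => expR (- (delta * t)))) /\
  \int[mu]_(t in `[T, +oo[) expR (- (delta * t)) = delta^-1 * expR (- (delta * T)).
Proof.
move=> d0; pose F t : R := - (delta^-1 * expR (- (delta * t))).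
have cE : continuous (fun t : R => expR (- (delta * t))).
  move=> t; apply: (@continuous_comp _ _ _ (fun t => - (delta * t)) expR).
    by apply: cvgN; apply: cvgM; [exact: cvg_cst|exact: cvg_id].
  exact: continuous_expR.
have dF : forall t : R, is_derive t 1 F (expR (- (delta * t))).
  move=> t.
  have := is_derive_expRM (- delta^-1) (- delta) t.
  rewrite mulrA mulrNN mulVf ?gt_eqF// mul1r mulNr.
  by rewrite (_ : (fun t => _) = F)//; apply/funext => r; rewrite /F !mulNr.
have lim0 : F x @[x --> +oo] --> (0 : R).
  rewrite -oppr0 -(mulr0 delta^-1); apply: cvgN; apply: cvgM; first exact: cvg_cst.
  apply: (@cvg_comp _ _ _ (fun x => delta * x) (fun x => expR (- x)) _ (+oo : set_system R)).
    exact: gt0_cvgMry.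
  exact: cvgr_expR.
have E : (\int[mu]_(t in `[T, +oo[) (expR (- (delta * t)))%:E = 0%:E - (F T)%:E)%E.
  apply: (@ge0_continuous_FTC2y _ (fun t => expR (- (delta * t))) F) => //.
  - exact: continuous_subspaceT.
  - apply: cvg_at_right_filter; apply: differentiable_continuous.
    exact/derivable1_diffP.
  - by move=> x _; rewrite derive1E derive_val.
split; last by rewrite /Rintegral E /F -EFinB /= sub0r opprK.
apply/integrableP; split.
  by apply/measurable_EFinP; apply: measurable_funTS; exact: continuous_measurable_fun.
under eq_integral do rewrite /= ger0_norm ?expR_ge0//.
by rewrite E ltry.
Qed.

End Integration.

(** * Admissible processes *)

Section Processes.
Context {R : realType} {n m : nat}.
Variables (l : R -> 'rV[R]_n -> 'rV[R]_m -> R)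
          (f : R -> 'rV[R]_n -> 'rV[R]_m -> 'rV[R]_n)
          (Omega : set 'rV[R]_m) (delta : R).
Local Notation mu := (@lebesgue_measure R).
Implicit Types (s t b T : R) (z : 'rV[R]_n) (x : R -> 'rV[R]_n) (u : R -> 'rV[R]_m).

(** Cutting an interval at [b] by [Num.min _ b] and [Num.max _ b] splits it into a part before
[b] and a part after [b]; this keeps the intervals disjoint and does not
increase their lengths, and the increment of the spliced function is the sum
of the increments over the two parts. *)
Lemma abs_continuous_splice s b T x1 x2 : s <= b -> b <= T -> x1 b = x2 b ->
  abs_continuous s b x1 -> abs_continuous b T x2 ->
  abs_continuous s T (splice b x1 x2).
Proof.
move=> sb bT x12 ac1 ac2 e e0; pose N : R := n%:R.
have N0 : 0 <= N by [].
have eN : 0 < e / (2 * (N + 1)) by rewrite divr_gt0//; lra.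
have [d1 d10 H1] := ac1 _ eN; have [d2 d20 H2] := ac2 _ eN.
exists (Num.min d1 d2); first by rewrite lt_min d10.
move=> k a c Hac Hdisj Hsum.
have le1 i : Num.min (c i) b - Num.min (a i) b <= c i - a i.
  by have [_ [h _]] := Hac i; case: (leP (c i) b); case: (leP (a i) b) => *; lra.
have le2 i : Num.max (c i) b - Num.max (a i) b <= c i - a i.
  by have [_ [h _]] := Hac i; case: (leP (c i) b); case: (leP (a i) b) => *; lra.
have S1 : \sum_(i < k) enorm (x1 (Num.min (c i) b) - x1 (Num.min (a i) b)) < e / (2 * (N + 1)).
  apply: H1 => [i|i j ij|].
  - have [h1 [h2 h3]] := Hac i; split; first by rewrite le_min h1.
    by split; [rewrite le_min2|rewrite ge_min lexx orbT].
  - by have [h|h] := Hdisj i j ij; [left|right]; rewrite le_min2.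
  - apply: le_lt_trans (lt_le_trans Hsum _); last by rewrite ge_min lexx.
    by apply: ler_sum => i _.
have S2 : \sum_(i < k) enorm (x2 (Num.max (c i) b) - x2 (Num.max (a i) b)) < e / (2 * (N + 1)).
  apply: H2 => [i|i j ij|].
  - have [h1 [h2 h3]] := Hac i; split; first by rewrite le_max lexx orbT.
    by split; [rewrite le_max2|rewrite ge_max h3].
  - by have [h|h] := Hdisj i j ij; [left|right]; rewrite le_max2.
  - apply: le_lt_trans (lt_le_trans Hsum _); last by rewrite ge_min lexx orbT.
    by apply: ler_sum => i _.
have split_splice r : splice b x1 x2 r = x1 (Num.min r b) + x2 (Num.max r b) - x1 b.
  rewrite /splice; case: leP => rb; first by rewrite x12 addrK.
  by rewrite addrC addKr.
have term i : enorm (splice b x1 x2 (c i) - splice b x1 x2 (a i)) <=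
    N * enorm (x1 (Num.min (c i) b) - x1 (Num.min (a i) b)) +
    N * enorm (x2 (Num.max (c i) b) - x2 (Num.max (a i) b)).
  rewrite (le_trans (enorm_le_norm _))// -/N -mulrDr ler_wpM2l//.
  rewrite !split_splice opprB addrA subrK opprD addrACA.
  by rewrite (le_trans (ler_normD _ _))// lerD// norm_le_enorm.
apply: (@le_lt_trans _ _ (N * (e / (2 * (N + 1))) + N * (e / (2 * (N + 1))))).
  apply: (le_trans (ler_sum _ (fun i _ => term i))).
  by rewrite big_split/= -!mulr_sumr lerD// ler_wpM2l// ltW.
rewrite (_ : _ + _ = e * (N / (N + 1))); last first.
  by field; rewrite lt0r_neq0//; lra.
by rewrite gtr_pMr// ltr_pdivrMr; lra.
Qed.

Lemma process_start s z x u : admissible_process f Omega s z x u -> x s = z.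
Proof.
case=> _ _ _ H; apply/rowP => i; rewrite (H s i (lexx _)) set_itv1.
by rewrite Rintegral_set1 addr0.
Qed.

Lemma admissible_splice s b z x1 u1 x2 u2 : s <= b ->
  admissible_process f Omega s z x1 u1 ->
  admissible_process f Omega b (x1 b) x2 u2 ->
  admissible_process f Omega s z (splice b x1 x2) (splice b u1 u2).
Proof.
move=> sb P1 P2; have x2b := process_start P2.
case: P1 => [[iu1 O1] ac1 if1 e1]; case: P2 => [[iu2 O2] ac2 if2 e2].
have fE i : (fun t => f t (splice b x1 x2 t) (splice b u1 u2 t) 0 i) =
    splice b (fun t => f t (x1 t) (u1 t) 0 i) (fun t => f t (x2 t) (u2 t) 0 i).
  by apply/funext => t; rewrite /splice; case: ifP.
have int_splice (h1 h2 : R -> R) :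
    (forall T, s <= T -> mu.-integrable `[s, T] (EFin \o h1)) ->
    (forall T, b <= T -> mu.-integrable `[b, T] (EFin \o h2)) ->
    forall T, s <= T -> mu.-integrable `[s, T] (EFin \o splice b h1 h2).
  move=> i1 i2 T sT; have [bT|/ltW Tb] := leP b T.
    by apply: integrable_splice; rewrite ?bnd_simp//; [exact: i1|exact: i2].
  apply: (@eq_integrable _ _ _ mu _ _ (EFin \o h1)) (i1 T sT) => // t.
  by rewrite inE /= in_itv/= => /andP[_ tT]; rewrite /splice (le_trans tT Tb).
split.
- split.
    move=> T i sT.
    rewrite (_ : (fun t => _) = EFin \o splice b (fun t => u1 t 0 i) (fun t => u2 t 0 i)).
      by apply: int_splice => // T' ?; [exact: iu1|exact: iu2].
    by apply/funext => t; rewrite /splice /=; case: ifP.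
  have FF : Filter (nbhs (almost_everywhere mu)) by exact: ae_filter_ringOfSetsType.
  apply: filterS2 O1 O2 => t h1 h2 st; rewrite /splice; case: leP => tb; first exact: h1.
  exact/h2/ltW.
- move=> T sT; have [bT|/ltW Tb] := leP b T.
    by apply: abs_continuous_splice => //; [exact: ac1|exact: ac2].
  move=> e e0; have [d d0 H] := ac1 T sT e e0; exists d => // k a c Hac Hd Hs.
  rewrite (eq_bigr (fun i => enorm (x1 (c i) - x1 (a i)))); first exact: H.
  move=> i _; have [h1 [h2 h3]] := Hac i.
  by rewrite /splice (le_trans h3 Tb) (le_trans h2 (le_trans h3 Tb)).
- move=> T i sT; have := int_splice _ _ (fun T => if1 T i) (fun T => if2 T i) T sT.
  by rewrite -fE.
- move=> t i st; rewrite [X in Rintegral _ _ X]fE; have [tb|/ltW bt] := leP t b.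
    by rewrite Rintegral_splice_le// {1}/splice tb; exact: e1.
  rewrite Rintegral_splice_ge ?bnd_simp//; [|exact: if1|exact: if2].
  rewrite addrA -e1// -e2//; rewrite /splice; case: leP => // tb.
  by rewrite (_ : t = b) ?x2b//; apply/eqP; rewrite eq_le tb.
Qed.

Definition running_rate x u t : R := expR (- (delta * t)) * l t (x t) (u t).

(** Measurability of the running cost is part of having a well-defined cost; it
is recorded separately for processes whose cost is not yet known to be
finite. *)
Definition measured_process s z x u :=
  admissible_process f Omega s z x u /\
  measurable_fun (`[s, +oo[ : set (measurableTypeR R)) (running_rate x u).

Lemma running_rate_splice b x1 x2 u1 u2 :
  running_rate (splice b x1 x2) (splice b u1 u2) =
  splice b (running_rate x1 u1) (running_rate x2 u2).
Proof. by apply/funext => t; rewrite /splice /running_rate; case: ifP. Qed.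

Lemma measured_splice s b z x1 u1 x2 u2 : s <= b ->
  measured_process s z x1 u1 -> measured_process b (x1 b) x2 u2 ->
  measured_process s z (splice b x1 x2) (splice b u1 u2).
Proof.
move=> sb [P1 m1] [P2 m2]; split; first exact: admissible_splice.
rewrite running_rate_splice; apply: measurable_splice => //.
by apply: measurable_funS m1 => //; apply: subset_itvl; rewrite bnd_simp.
Qed.

Lemma finite_cost_measured s z x u :
  finite_cost_process l f Omega delta s z x u -> measured_process s z x u.
Proof. by case=> P [mg _] _; split => //; apply/measurable_EFinP. Qed.

(** Absolute continuity bounds the increments over intervals shorter than some
[d] by 1, and the interval is a chain of finitely many such intervals. *)
Lemma process_locally_bounded s z x u T : admissible_process f Omega s z x u ->
  exists2 M, 0 <= M & forall t, s <= t <= T -> `|x t| <= M.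
Proof.
move=> [_ ac _ _]; have [sT|Ts] := leP s T; last first.
  by exists 0 => // t /andP[h1 h2]; move: (le_trans h1 h2); rewrite leNgt Ts.
have [d d0 Hd] := ac T sT _ ltr01.
have step a c : s <= a -> a <= c -> c <= T -> c - a < d -> `|x c| <= `|x a| + 1.
  move=> sa ac' cT cad.
  have := Hd 1%N (fun _ => a) (fun _ => c); rewrite !big_ord1 => H.
  have e1 : enorm (x c - x a) < 1.
    by apply: H => // i j; rewrite !ord1.
  clear Hd H; have := norm_le_enorm (x c - x a); have := ler_normD (x c - x a) (x a).
  by rewrite subrK; lra.
clear Hd; have d20 : 0 < d / 2 by rewrite divr_gt0.
have bnd (k : nat) t : s <= t <= T -> t <= s + k%:R * (d / 2) -> `|x t| <= `|x s| + k%:R.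
  elim: k t => [|k IH] t /andP[st tT].
    by rewrite mul0r !addr0 => ts; rewrite (_ : t = s)//; apply/eqP; rewrite eq_le ts.
  rewrite -natr1 mulrDl mul1r => tk.
  have [h|h] := leP t (s + k%:R * (d / 2)).
    by have := IH t; rewrite st tT => /(_ isT h); lra.
  pose a := s + k%:R * (d / 2).
  have sa : s <= a by rewrite /a lerDl mulr_ge0// ltW.
  have aT : a <= T by rewrite /a; lra.
  have := IH a; rewrite sa aT => /(_ isT (lexx _)) h2.
  have := step a t sa (ltW h) tT; rewrite {1}/a => h3.
  have : `|x t| <= `|x a| + 1 by apply: h3; lra.
  lra.
exists (`|x s| + (Num.bound ((T - s) / (d / 2)))%:R); first by rewrite addr_ge0.
move=> t tT; apply: bnd => //; case/andP: tT => st tT.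
rewrite -lerBlDl -ler_pdivrMr//.
have h : t - s <= T - s by lra.
have h2 : (t - s) / (d / 2) <= (T - s) / (d / 2) by rewrite ler_pM2r ?invr_gt0.
apply: (le_trans h2); apply/ltW/archi_boundP.
apply: divr_ge0; last exact: ltW.
by rewrite subr_ge0.
Qed.

Lemma process_increment s z x u r t i : admissible_process f Omega s z x u ->
  s <= r -> r <= t ->
  x t 0 i - x r 0 i = \int[mu]_(q in `[r, t]) f q (x q) (u q) 0 i.
Proof.
move=> [_ _ ifi E] sr rt; rewrite (E t i (le_trans sr rt)) (E r i sr).
rewrite (Rintegral_itv_split sr _ (ifi _ _ (le_trans sr rt))) ?bnd_simp//.
ring.
Qed.

Variable K : R.
Hypothesis K0 : 0 <= K.
Hypothesis delta_gt0 : 0 < delta.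
Hypothesis boundl : forall (t : R) (y : 'rV[R]_n) v, 0 <= t -> Omega v -> `|l t y v| <= K * (1 + `|y|).
Hypothesis boundf : forall (t : R) (y : 'rV[R]_n) v, 0 <= t -> Omega v -> `|f t y v| <= K * (1 + `|y|).

Lemma ae_velocity_bound s z x u M (D : set R) : 0 <= s ->
  admissible_process f Omega s z x u -> D `<=` `[s, +oo[ ->
  (forall t, D t -> `|x t| <= M) ->
  {ae mu, forall t, D t -> `|f t (x t) (u t)| <= K * (1 + M)}.
Proof.
move=> s0 [[_ O] _ _ _] Ds xM.
have FF : Filter (nbhs (almost_everywhere mu)) by exact: ae_filter_ringOfSetsType.
apply: filterS O => t Ot Dt; have := Ds t Dt; rewrite /= in_itv/= andbT => st.
rewrite (le_trans (boundf _ (le_trans s0 st) (Ot st)))// ler_wpM2l// lerD2l.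
exact: xM.
Qed.

Lemma process_lipschitz s z x u M : 0 <= s -> 0 <= M ->
  admissible_process f Omega s z x u -> (forall t, s <= t -> `|x t| <= M) ->
  forall r t, s <= r -> r <= t -> `|x t - x r| <= K * (1 + M) * (t - r).
Proof.
move=> s0 M0 P xM r t sr rt; have KM : 0 <= K * (1 + M) by rewrite mulr_ge0//; lra.
apply: norm_leP => [|i]; first by rewrite mulr_ge0//; lra.
rewrite !mxE (process_increment i P sr rt) -Rintegral_cst_itv//.
have [_ _ ifi _] := P.
have ii : mu.-integrable `[r, t] (EFin \o (fun q => f q (x q) (u q) 0 i)).
  apply: (integrable_sub_itv _ (ifi t i (le_trans sr rt))).
  by rewrite /Order.le/= !bnd_simp sr.
apply: norm_Rintegral_le_ae => //.
- by apply/measurable_EFinP; exact: measurable_int ii.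
- exact: integrable_cst_itv.
have FF : Filter (nbhs (almost_everywhere mu)) by exact: ae_filter_ringOfSetsType.
have := @ae_velocity_bound s z x u M `[r, t] s0 P; have Ds : `[r, t] `<=` `[s, +oo[.
  by move=> q /=; rewrite !in_itv/= andbT => /andP[h _]; exact: le_trans h.
move=> /(_ Ds) H; apply: filterS (H _).
  by move=> q Hq Dq; apply: le_trans (Hq Dq); exact: normE.
move=> q Dq; apply: xM; have := Ds q Dq; by rewrite /= in_itv/= andbT.
Qed.

Lemma ae_rate_bound s z x u M (D : set R) : 0 <= s ->
  admissible_process f Omega s z x u -> D `<=` `[s, +oo[ ->
  (forall t, D t -> `|x t| <= M) ->
  {ae mu, forall t, D t ->
    `|running_rate x u t| <= K * (1 + M) * expR (- (delta * t))}.
Proof.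
move=> s0 [[_ O] _ _ _] Ds xM.
have FF : Filter (nbhs (almost_everywhere mu)) by exact: ae_filter_ringOfSetsType.
apply: filterS O => t Ot Dt; have := Ds t Dt; rewrite /= in_itv/= andbT => st.
rewrite /running_rate normrM ger0_norm ?expR_ge0// mulrC ler_wpM2r ?expR_ge0//.
rewrite (le_trans (boundl _ (le_trans s0 st) (Ot st)))// ler_wpM2l// lerD2l.
exact: xM.
Qed.

Lemma integrable_discount k T :
  mu.-integrable `[T, +oo[ (EFin \o (fun t => k * expR (- (delta * t)))).
Proof.
rewrite (_ : EFin \o _ = (fun t => k%:E * (EFin \o (fun t => expR (- (delta * t)))) t)%E).
  by apply: integrableZl => //; have [] := expR_discount T delta_gt0.
by apply/funext => t; rewrite /= EFinM.
Qed.

Lemma rate_integrable s z x u M (c : itv_bound R) : 0 <= s ->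
  measured_process s z x u ->
  (forall t, t \in Interval (BLeft s) c -> `|x t| <= M) ->
  mu.-integrable [set` Interval (BLeft s) c] (EFin \o running_rate x u).
Proof.
move=> s0 [P mg] xM.
have Ds : [set` Interval (BLeft s) c] `<=` `[s, +oo[.
  by apply: subset_itvl; case: c {xM} => [? ?|[]].
apply: (@integrable_ae_dominated _ _ _ (fun t => K * (1 + M) * expR (- (delta * t)))).
- by [].
- by apply: measurable_funS mg.
- by apply: integrableS (integrable_discount _ s).
- exact: ae_rate_bound P Ds xM.
Qed.

Lemma rate_integrable_locally s z x u T : 0 <= s -> measured_process s z x u ->
  mu.-integrable `[s, T] (EFin \o running_rate x u).
Proof.
move=> s0 P; have [M M0 xM] := process_locally_bounded T P.1.
apply: (rate_integrable (M := M) s0 P) => t; rewrite in_itv/=; exact: xM.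
Qed.

Lemma integrable_finite_cost s z x u : measured_process s z x u ->
  mu.-integrable `[s, +oo[ (EFin \o running_rate x u) ->
  finite_cost_process l f Omega delta s z x u /\
  cost l delta s x u = (\int[mu]_(t in `[s, +oo[) running_rate x u t)%:E.
Proof.
move=> P ig.
have fin := integrable_fin_num (_ : measurable (`[s, +oo[%classic : set (measurableTypeR R))) ig.
have E : cost l delta s x u = (\int[mu]_(t in `[s, +oo[) running_rate x u t)%:E.
  by rewrite /Rintegral fineK//; apply: fin.
split => //; split; [exact: P.1| |by rewrite E ltry].
split; first exact: measurable_int ig.
by left; apply: integral_funepos_lt_pinfty ig.
Qed.

Lemma rate_tail s z x u M T : 0 <= s -> 0 <= M ->
  measured_process s z x u -> (forall t, s <= t -> `|x t| <= M) -> s <= T ->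
  `|\int[mu]_(t in `[s, +oo[) running_rate x u t
    - \int[mu]_(t in `[s, T]) running_rate x u t|
   <= K * (1 + M) * (delta^-1 * expR (- (delta * T))).
Proof.
move=> s0 M0 P xM sT.
have ig : mu.-integrable `[s, +oo[ (EFin \o running_rate x u).
  by apply: (rate_integrable (M := M) s0 P) => t; rewrite in_itv/= andbT; exact: xM.
rewrite (Rintegral_itv_split sT _ ig)// addrAC subrr add0r.
have [id <-] := expR_discount T delta_gt0.
rewrite -RintegralZl//.
have Ds : `[T, +oo[ `<=` `[s, +oo[ by apply: subset_itvr; rewrite bnd_simp.
apply: norm_Rintegral_le_ae => //.
- by apply: measurable_funS P.2.
- exact: integrable_discount.
apply: (ae_rate_bound s0 P.1 Ds) => t; rewrite /= in_itv/= andbT => Tt.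
by apply: xM; exact: le_trans Tt.
Qed.

End Processes.

(** * Picard iteration *)

Section Picard.
Context {R : realType} {n : nat}.
Local Notation mu := (@lebesgue_measure R).
Variables (F : R -> 'rV[R]_n -> 'rV[R]_n) (K B a : R) (z : 'rV[R]_n).
Hypothesis cF : continuous (fun p : R * 'rV[R]_n => F p.1 p.2).
Hypothesis K0 : 0 < K.
Hypothesis lipF : forall t x y, `|F t x - F t y| <= K * `|x - y|.
Hypothesis boundFz : forall t, `|F t z| <= B.

Lemma continuous_integrable_itv (h : R -> R) b c : continuous h ->
  mu.-integrable `[b, c] (EFin \o h).
Proof.
move=> ch; apply: continuous_compact_integrable; first exact: segment_compact.
exact: continuous_subspaceT.
Qed.

Lemma continuous_primitive (h : R -> R) : continuous h ->
  continuous (fun t => \int[mu]_(s in `[a, Num.max t a]) h s).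
Proof.
move=> ch t0; pose T := Num.max t0 a + 1.
have am : a <= Num.max t0 a by rewrite le_max lexx orbT.
have aT : a <= T by rewrite /T; lra.
have c1 := parameterized_integral_continuous aT (continuous_integrable_itv a T ch).
have cr : continuous (fun t : R => Num.max (Num.min t T) a).
  move=> t; apply: (@continuous_max _ _ (fun t => Num.min t T) (fun=> a)).
    apply: (@continuous_min _ _ (fun t => t) (fun=> T)); first exact: cvg_id.
    exact: cvg_cst.
  exact: cvg_cst.
have c2 := continuous_retract c1 cr.
have E t : t < T -> Num.max (Num.min t T) a = Num.max t a.
  by move=> tT; rewrite min_l// ltW.
have t0T : t0 < T.
  have tm : t0 <= Num.max t0 a by rewrite le_max lexx.
  by rewrite /T; lra.
have rT t : `[a, T]%classic (Num.max (Num.min t T) a).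
  by rewrite /= in_itv/= le_max lexx orbT /= ge_max aT ge_min lexx orbT.
move: (c2 rT t0); rewrite /continuous_at /= E// => c3.
apply: cvg_trans c3; apply: near_eq_cvg.
near=> t; rewrite /= E//; near: t.
exact: lt_nbhsl.
Unshelve. all: by end_near. Qed.

Fixpoint picard k : R -> 'rV[R]_n :=
  if k is k'.+1 then
    fun t => \row_i (z 0 i + \int[mu]_(s in `[a, Num.max t a]) F s (picard k' s) 0 i)
  else fun=> z.

Lemma continuous_along (x : R -> 'rV[R]_n) : continuous x ->
  continuous (fun t => F t (x t)).
Proof.
move=> cx t; apply: (@continuous_comp _ _ _ (fun t => (t, x t)) (fun p => F p.1 p.2)).
  exact: (continuous_pair (@continuous_id _) cx).
exact: cF.
Qed.

Lemma continuous_along_coord (x : R -> 'rV[R]_n) i : continuous x ->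
  continuous (fun t => F t (x t) 0 i).
Proof.
move=> cx t.
apply: (@continuous_comp _ _ _ (fun t => F t (x t)) (fun v : 'rV[R]_n => v 0 i)).
  exact: continuous_along.
exact: coord_continuous.
Qed.

Lemma continuous_row (x : R -> 'rV[R]_n) :
  (forall i, continuous (fun t => x t 0 i)) -> continuous x.
Proof.
move=> cx t; apply/cvgrPdist_le => e e0.
have Hi (i : 'I_n) : \forall t' \near t, `|x t 0 i - x t' 0 i| <= e.
  by have /cvgrPdist_le/(_ _ e0) := cx i t.
have H := @filter_forall _ 'I_n _ _ (nbhs_filter t) Hi.
apply: filterS H => t' H; apply: norm_leP => [|i]; first exact: ltW.
by rewrite !mxE; exact: H.
Qed.

Lemma continuous_picard k : continuous (picard k).
Proof.
elim: k => [|k IH] /=; first by move=> t; exact: cvg_cst.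
apply: continuous_row => i.
rewrite (_ : (fun t => _) = (fun t => z 0 i + \int[mu]_(s in `[a, Num.max t a]) F s (picard k s) 0 i)).
  move=> t; apply: cvgD; first exact: cvg_cst.
  by apply: continuous_primitive; exact: continuous_along_coord.
by apply/funext => t; rewrite mxE.
Qed.

(** In the supremum norm weighted by [1 / w] the Picard operator contracts by the
factor 1/2 on the whole half-line, so that the solution is global at once.  The
constant [C] bounds the first step. *)
Let w t := expR (2 * K * Num.max t a).
Let C := B / (2 * K) * expR (- (2 * K * a)).

Let w_ge0 t : 0 <= w t. Proof. exact: expR_ge0. Qed.

Let B0 : 0 <= B. Proof. exact: le_trans (boundFz 0). Qed.

Let C0 : 0 <= C.
Proof. by rewrite mulr_ge0 ?expR_ge0// divr_ge0// mulr_ge0// ltW. Qed.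

(** The weight grows at the rate 2 K, so integrating it divides it by 2 K; together
with the Lipschitz constant K this leaves the factor 1/2. *)
Lemma weight_integral (c t : R) : 0 <= c -> a <= t ->
  \int[mu]_(s in `[a, t]) (c * (2 * K * expR (2 * K * s))) <= c * expR (2 * K * t).
Proof.
move=> c0; rewrite le_eqVlt => /predU1P[<-|at_].
  by rewrite set_itv1 Rintegral_set1 mulr_ge0 ?expR_ge0.
pose G (s : R) : R := c * expR (2 * K * s).
have dG (s : R) : is_derive s 1 G (c * (2 * K * expR (2 * K * s))) by exact: is_derive_expRM.
have cG : continuous G.
  by move=> s; apply: differentiable_continuous; exact/derivable1_diffP.
have E : (\int[mu]_(s in `[a, t]) (c * (2 * K * expR (2 * K * s)))%:E = (G t)%:E - (G a)%:E)%E.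
  apply: (@continuous_FTC2 _ (fun s => c * (2 * K * expR (2 * K * s))) G) => //.
  - apply: continuous_subspaceT => s; apply: cvgM; first exact: cvg_cst.
    apply: cvgM; first exact: cvg_cst.
    apply: (@continuous_comp _ _ _ (fun s => 2 * K * s) expR).
      by apply: cvgM; [exact: cvg_cst|exact: cvg_id].
    exact: continuous_expR.
  - split; [by move=> s _; exact: ex_derive| |].
      by apply: cvg_at_right_filter; exact: cG.
    by apply: cvg_at_left_filter; exact: cG.
  - by move=> s _; rewrite derive1E derive_val.
by rewrite /Rintegral E -EFinB /= lerBlDr lerDl mulr_ge0 ?expR_ge0.
Qed.

Lemma picard_step k t : `|picard k.+1 t - picard k t| <= C / 2 ^+ k * w t.
Proof.
have [M aM tM] : exists2 M, a <= M & M = Num.max t a.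
  by exists (Num.max t a) => //; rewrite le_max lexx orbT.
elim: k t M aM tM => [|k IH] t M aM tM.
  rewrite expr0 divr1; apply: norm_leP => [|i]; first by rewrite mulr_ge0.
  rewrite !mxE addrC addKr -tM.
  have H : `|\int[mu]_(s in `[a, M]) F s z 0 i| <= B * (M - a).
    rewrite -Rintegral_cst_itv//; apply: norm_Rintegral_le_ae => //.
    - apply/measurable_EFinP; apply: measurable_int (continuous_integrable_itv _ _ _).
      exact: (@continuous_along_coord (fun=> z)) (fun=> cvg_cst _).
    - exact: integrable_cst_itv.
    - by apply: aeW => s _; exact: le_trans (normE _ _) (boundFz s).
  have -> : C * w t = B / (2 * K) * expR (2 * K * (M - a)).
    by rewrite /C /w -tM -mulrA -expRD; congr (_ * expR _); ring.
  apply: (le_trans H); rewrite -mulrA ler_wpM2l// mulrC ler_pdivlMr ?mulr_gt0//.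
  have := expR_ge1Dx (2 * K * (M - a)); lra.
apply: norm_leP => [|i]; first by rewrite mulr_ge0// divr_ge0// exprn_ge0.
rewrite !mxE -tM opprD addrACA subrr add0r.
have i1 := continuous_integrable_itv a M (@continuous_along_coord _ i (@continuous_picard k.+1)).
have i2 := continuous_integrable_itv a M (@continuous_along_coord _ i (@continuous_picard k)).
rewrite -RintegralB//.
have c0 : 0 <= C / 2 ^+ k / 2 by rewrite !divr_ge0// exprn_ge0.
rewrite (_ : C / 2 ^+ k.+1 = C / 2 ^+ k / 2); last by rewrite exprS invfM mulrA mulrAC.
rewrite /w -tM; apply: le_trans (weight_integral c0 aM).
apply: norm_Rintegral_le_ae => //.
- by apply: measurable_funB; apply/measurable_EFinP; [exact: measurable_int i1|exact: measurable_int i2].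
- apply: continuous_integrable_itv => s; apply: cvgM; first exact: cvg_cst.
  apply: cvgM; first exact: cvg_cst.
  apply: (@continuous_comp _ _ _ (fun s => 2 * K * s) expR).
    by apply: cvgM; [exact: cvg_cst|exact: cvg_id].
  exact: continuous_expR.
apply: aeW => s /=; rewrite in_itv/= => /andP[as_ _].
have := normE (F s (picard k.+1 s) - F s (picard k s)) i; rewrite !mxE => H.
rewrite (le_trans H)// (le_trans (lipF _ _ _))//.
have sE : s = Num.max s a by rewrite max_l.
have := IH s s as_ sE; rewrite {1}/w -sE => H2.
apply: le_trans (ler_wpM2l (ltW K0) H2) _.
by rewrite le_eqVlt; apply/orP; left; apply/eqP; field; rewrite expf_neq0.
Qed.

Lemma picard_tail k j t : `|picard (k + j) t - picard k t| <= 2 * (C / 2 ^+ k * w t).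
Proof.
suff H : `|picard (k + j) t - picard k t| <= 2 * (C / 2 ^+ k * w t) * (1 - 2 ^- j).
  apply: (le_trans H); rewrite ler_piMr ?lerBlDr ?lerDl ?invr_ge0 ?exprn_ge0//.
  by rewrite mulr_ge0// mulr_ge0// divr_ge0// exprn_ge0.
elim: j => [|j IH]; first by rewrite addn0 expr0 invr1 !subrr normr0 mulr0.
rewrite addnS -(subrKA (picard (k + j) t)).
apply: (le_trans (ler_normD _ _)); apply: (le_trans (lerD (picard_step _ _) IH)).
rewrite exprD exprS le_eqVlt; apply/orP; left; apply/eqP.
by field; rewrite !expf_neq0.
Qed.

Definition picard_limit t : 'rV[R]_n := lim (picard k t @[k --> \oo]).

Let geometric_small (c e : R) : 0 <= c -> 0 < e -> exists k : nat, c / 2 ^+ k < e.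
Proof.
move=> c0 e0; exists (Num.bound (c / e)); rewrite ltr_pdivrMr ?exprn_gt0// -ltr_pdivrMl//.
apply: (@lt_trans _ _ (Num.bound (c / e))%:R).
  by rewrite mulrC archi_boundP// divr_ge0// ltW.
by rewrite -natrX ltr_nat ltn_expl.
Qed.

Lemma picard_cvg t : picard k t @[k --> \oo] --> picard_limit t.
Proof.
apply: (@cauchy_cvg _ (picard k t @[k --> \oo])); apply: cauchy_exP => e e0.
have [k Hk] := @geometric_small (2 * (C * w t)) _ (mulr_ge0 (ler0n _ 2) (mulr_ge0 C0 (w_ge0 t))) e0.
exists (picard k t); exists k => // j /= kj; rewrite -ball_normE /ball_ /= distrC.
rewrite -(subnKC kj); apply: le_lt_trans (picard_tail _ _ _) _.
by apply: le_lt_trans Hk; rewrite -!mulrA (mulrC (w t)).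
Qed.

Lemma picard_limit_close k t : `|picard_limit t - picard k t| <= 2 * (C / 2 ^+ k * w t).
Proof.
apply/ler_addgt0Pr => e e0.
have /cvgrPdist_lt/(_ _ e0)[N _ HN] := @picard_cvg t.
have := HN (k + N)%N (leq_addl _ _) => /= h1; have := picard_tail k N t => h2.
rewrite -(subrKA (picard (k + N) t)); apply: (le_trans (ler_normD _ _)).
by rewrite addrC lerD// ltW.
Qed.

Let w_mono t t' : t <= t' -> w t <= w t'.
Proof.
move=> tt'; rewrite /w ler_expR ler_pM2l ?mulr_gt0//.
by rewrite ge_max !le_max tt' lexx orbT.
Qed.

Lemma continuous_picard_limit : continuous picard_limit.
Proof.
move=> t; apply/cvgrPdist_lt => e e0.
have e30 : 0 < e / 3 by rewrite divr_gt0.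
have [k Hk] := @geometric_small (2 * (C * w (t + 1))) _
  (mulr_ge0 (ler0n _ 2) (mulr_ge0 C0 (w_ge0 (t + 1)))) e30.
have close t' : t' < t + 1 -> `|picard_limit t' - picard k t'| < e / 3.
  move=> tt'; apply: le_lt_trans (picard_limit_close _ _) _; apply: le_lt_trans Hk.
  rewrite (_ : 2 * _ / _ = 2 * (C / 2 ^+ k * w (t + 1))); last first.
    by rewrite -!mulrA (mulrC (w _)).
  rewrite ler_wpM2l// ler_wpM2l ?divr_ge0 ?exprn_ge0//.
  by apply: w_mono; exact: ltW.
have /cvgrPdist_lt/(_ _ e30) ck := @continuous_picard k t.
near=> t'.
have h1 : `|picard_limit t - picard k t| < e / 3 by apply: close; rewrite ltrDl.
have h2 : `|picard_limit t' - picard k t'| < e / 3.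
  by apply: close; near: t'; apply: lt_nbhsl; rewrite ltrDl.
have h3 : `|picard k t - picard k t'| < e / 3 by near: t'.
rewrite (_ : picard_limit t - picard_limit t' = (picard_limit t - picard k t)
  + (picard k t - picard k t') - (picard_limit t' - picard k t')); last first.
  by apply/matrixP => i j; rewrite !mxE; ring.
have := ler_normB (picard_limit t - picard k t + (picard k t - picard k t'))
  (picard_limit t' - picard k t').
have := ler_normD (picard_limit t - picard k t) (picard k t - picard k t').
lra.
Unshelve. all: by end_near. Qed.

(** Both sides are limits of the two sides of the recurrence, with errors of order
[2 ^- k]. *)
Lemma picard_solution t i : a <= t ->
  picard_limit t 0 i = z 0 i + \int[mu]_(s in `[a, t]) F s (picard_limit s) 0 i.
Proof.
move=> at_; set J := \int[mu]_(s in _) _.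
have i1 := continuous_integrable_itv a t (@continuous_along_coord _ i continuous_picard_limit).
pose D := 2 * (C * w t) * (1 + K * (t - a)).
have key k : `|picard_limit t 0 i - (z 0 i + J)| <= D / 2 ^+ k.
  have i2 := continuous_integrable_itv a t (@continuous_along_coord _ i (@continuous_picard k)).
  have E : picard k.+1 t 0 i = z 0 i + \int[mu]_(s in `[a, t]) F s (picard k s) 0 i.
    by rewrite /= mxE max_l.
  pose J' := \int[mu]_(s in `[a, t]) F s (picard k s) 0 i.
  have c0 : 0 <= 2 * (C / 2 ^+ k * w t).
    by rewrite mulr_ge0// mulr_ge0// divr_ge0// exprn_ge0.
  have JJ : `|J' - J| <= K * (2 * (C / 2 ^+ k * w t)) * (t - a).
    rewrite /J' /J -RintegralB// -Rintegral_cst_itv//.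
    apply: norm_Rintegral_le_ae => //.
    - by apply: measurable_funB; apply/measurable_EFinP; [exact: measurable_int i2|exact: measurable_int i1].
    - exact: integrable_cst_itv.
    apply: aeW => s /=; rewrite in_itv/= => /andP[as_ st].
    have := normE (F s (picard k s) - F s (picard_limit s)) i; rewrite !mxE => H.
    rewrite (le_trans H)// (le_trans (lipF _ _ _))// ler_wpM2l ?(ltW K0)//.
    rewrite distrC (le_trans (picard_limit_close _ _))// ler_wpM2l//.
    by rewrite ler_wpM2l ?divr_ge0 ?exprn_ge0// w_mono.
  have L1 : `|picard_limit t 0 i - picard k.+1 t 0 i| <= 2 * (C / 2 ^+ k * w t).
    have := normE (picard_limit t - picard k.+1 t) i; rewrite !mxE => H.
    rewrite (le_trans H)// (le_trans (picard_limit_close _ _))// ler_wpM2l//.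
    rewrite ler_wpM2r// ler_wpM2l// lef_pV2 ?posrE ?exprn_gt0//.
    by rewrite exprS ler_peMl ?exprn_ge0// ler1n.
  rewrite (_ : _ - (z 0 i + J) = (picard_limit t 0 i - picard k.+1 t 0 i) + (J' - J)); last first.
    by rewrite E -/J'; ring.
  rewrite (le_trans (ler_normD _ _))// (le_trans (lerD L1 JJ))//.
  rewrite le_eqVlt; apply/orP; left; apply/eqP; rewrite /D.
  by field; rewrite expf_neq0.
apply/eqP; rewrite -subr_eq0 -normr_le0; apply/ler_addgt0Pr => e e0.
have D0 : 0 <= D.
  rewrite mulr_ge0 ?(mulr_ge0 (ler0n _ 2) (mulr_ge0 C0 (w_ge0 t)))//.
  by rewrite addr_ge0// mulr_ge0 ?subr_ge0// ltW.
have [k Hk] := geometric_small D0 e0.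
by rewrite add0r; apply: (le_trans (key k)); exact: ltW.
Qed.

End Picard.

(** * Processes with a constant control *)

Section ConstantControl.
Context {R : realType} {n m : nat}.
Variables (l : R -> 'rV[R]_n -> 'rV[R]_m -> R)
          (f : R -> 'rV[R]_n -> 'rV[R]_m -> 'rV[R]_n)
          (Omega : set 'rV[R]_m) (delta K : R).
Local Notation mu := (@lebesgue_measure R).
Hypothesis K0 : 0 < K.
Hypothesis lipf : forall (t : R) v (y y' : 'rV[R]_n), 0 <= t -> Omega v ->
  `|f t y v - f t y' v| <= K * `|y - y'|.
Hypothesis boundf : forall (t : R) (y : 'rV[R]_n) v, 0 <= t -> Omega v ->
  `|f t y v| <= K * (1 + `|y|).
Hypothesis cl : {within [set p : R * 'rV[R]_n * 'rV[R]_m | 0 <= p.1.1],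
     continuous (fun p : R * 'rV[R]_n * 'rV[R]_m => l p.1.1 p.1.2 p.2)}.
Hypothesis cf : {within [set p : R * 'rV[R]_n * 'rV[R]_m | 0 <= p.1.1],
     continuous (fun p : R * 'rV[R]_n * 'rV[R]_m => f p.1.1 p.1.2 p.2)}.

Lemma lipschitz_abs_continuous s T k (x : R -> 'rV[R]_n) : 0 <= k ->
  (forall r t, s <= r -> r <= t -> t <= T -> `|x t - x r| <= k * (t - r)) ->
  abs_continuous s T x.
Proof.
move=> k0 Hx e e0; pose d := e / (n%:R * k + 1).
have nk : 0 <= n%:R * k by rewrite mulr_ge0.
have d0 : 0 < d by rewrite divr_gt0//; lra.
exists d => // N a b Hab _ Hs.
apply: (@le_lt_trans _ _ (n%:R * k * \sum_(i < N) (b i - a i))).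
  rewrite mulr_sumr; apply: ler_sum => i _; have [h1 [h2 h3]] := Hab i.
  by rewrite (le_trans (enorm_le_norm _))// -mulrA ler_wpM2l// Hx.
apply: (@le_lt_trans _ _ (n%:R * k * d)); first by rewrite ler_wpM2l// ltW.
rewrite /d mulrCA gtr_pMr// ltr_pdivrMr; lra.
Qed.

Lemma constant_control_process a (z : 'rV[R]_n) v : 0 <= a -> Omega v ->
  exists x, measured_process l f Omega delta a z x (fun=> v).
Proof.
move=> a0 Ov; pose F t y := clamp f t y v.
have t0 (t : R) : 0 <= Num.max t 0 by rewrite le_max lexx orbT.
have cF : continuous (fun p : R * 'rV[R]_n => F p.1 p.2).
  move=> p; apply: (@continuous_comp _ _ _ (fun p : R * 'rV[R]_n => (p, v))
     (fun p => clamp f p.1.1 p.1.2 p.2)); last exact: continuous_clamp3.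
  exact: (continuous_pair (@continuous_id _) (@continuous_cst _ _ v)).
have lipF t x y : `|F t x - F t y| <= K * `|x - y| by exact: lipf.
have bF t : `|F t z| <= K * (1 + `|z|) by exact: boundf.
pose x := picard_limit F a z.
have cx : continuous x by exact: (continuous_picard_limit cF K0 lipF bF).
have xE t i : a <= t -> x t 0 i = z 0 i + \int[mu]_(s in `[a, t]) F s (x s) 0 i.
  by move=> at_; exact: (picard_solution cF K0 lipF bF).
have fE (t : R) : a <= t -> f t (x t) v = F t (x t).
  by move=> at_; rewrite /F clampE// (le_trans a0 at_).
have P : admissible_process f Omega a z x (fun=> v).
  have iF (T : R) i : mu.-integrable `[a, T] (EFin \o (fun t => F t (x t) 0 i)).
    by apply: continuous_integrable_itv; exact: continuous_along_coord.
  split.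
  - split; last by apply: aeW => t.
    by move=> T i _; exact: integrable_cst_itv.
  - move=> T aT.
    have [M M0 xM] : exists2 M, 0 < M & forall t, a <= t <= T -> `|x t| < M.
      have := compact_bounded (continuous_compact (continuous_subspaceT cx) (@segment_compact _ a T)).
      move=> /ex_strict_bound_gt0[M M0 HM]; exists M => // t tT.
      by apply: HM; exists t => //=; rewrite in_itv.
    apply: (@lipschitz_abs_continuous _ _ (K * (1 + M))) => [|r t ar rt tT].
      by rewrite mulr_ge0 ?(ltW K0)// addr_ge0// ltW.
    apply: norm_leP => [|i].
      by rewrite mulr_ge0 ?subr_ge0// mulr_ge0 ?(ltW K0)// addr_ge0// ltW.
    rewrite !mxE (xE t i (le_trans ar rt)) (xE r i ar).
    rewrite (Rintegral_itv_split ar _ (iF _ _)) ?bnd_simp//.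
    rewrite opprD addrACA subrr add0r addrAC subrr add0r -Rintegral_cst_itv//.
    have ir : mu.-integrable `[r, t] (EFin \o (fun s => F s (x s) 0 i)).
      by apply: continuous_integrable_itv; exact: continuous_along_coord.
    apply: norm_Rintegral_le_ae => //.
    + by apply/measurable_EFinP; exact: measurable_int ir.
    + exact: integrable_cst_itv.
    + apply: aeW => s /=; rewrite in_itv/= => /andP[rs st].
      rewrite (le_trans (normE _ _))// (le_trans (boundf _ (t0 _) Ov))//.
      rewrite ler_wpM2l ?(ltW K0)// lerD2l ltW// xM//.
      by rewrite (le_trans ar rs) (le_trans st tT).
  - move=> T i aT; apply: (@eq_integrable _ _ _ mu _ _ (EFin \o (fun t => F t (x t) 0 i))) => //.
    by move=> t; rewrite inE/= in_itv/= => /andP[at_ _]; rewrite fE.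
  - move=> t i at_; rewrite xE//; congr (_ + _); apply: eq_Rintegral => s.
    by rewrite inE/= in_itv/= => /andP[as_ _]; rewrite fE.
exists x; split => //.
have clx : continuous (fun t => expR (- (delta * t)) * clamp l t (x t) v).
  move=> t; apply: cvgM.
    apply: (@continuous_comp _ _ _ (fun t => - (delta * t)) expR).
      by apply: cvgN; apply: cvgM; [exact: cvg_cst|exact: cvg_id].
    exact: continuous_expR.
  apply: (@continuous_comp _ _ _ (fun t => (t, x t, v)) (fun p => clamp l p.1.1 p.1.2 p.2)).
    exact: (continuous_pair (continuous_pair (@continuous_id _) cx) (@continuous_cst _ _ v)).
  exact: continuous_clamp3.
apply: (eq_measurable_fun (fun t => expR (- (delta * t)) * clamp l t (x t) v)).
  move=> t; rewrite inE/= in_itv/= andbT => at_.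
  by rewrite /running_rate clampE// (le_trans a0 at_).
by apply: measurable_funTS; exact: continuous_measurable_fun.
Qed.

End ConstantControl.

(** * Comparison with the value function *)

Section Comparison.
Context {R : realType} {n m : nat}.
Variables (l : R -> 'rV[R]_n -> 'rV[R]_m -> R)
          (f : R -> 'rV[R]_n -> 'rV[R]_m -> 'rV[R]_n)
          (Omega : set 'rV[R]_m) (delta K : R).
Local Notation mu := (@lebesgue_measure R).
Local Notation V := (value_function l f Omega delta).
Hypothesis delta_gt0 : 0 < delta.
Hypothesis V_real : forall (t : R) (z : 'rV[R]_n), 0 <= t -> V t z \is a fin_num.
Hypothesis K0 : 0 < K.
Hypothesis lipf : forall (t : R) v (y y' : 'rV[R]_n), 0 <= t -> Omega v ->
  `|f t y v - f t y' v| <= K * `|y - y'|.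
Hypothesis boundl : forall (t : R) (y : 'rV[R]_n) v, 0 <= t -> Omega v ->
  `|l t y v| <= K * (1 + `|y|).
Hypothesis boundf : forall (t : R) (y : 'rV[R]_n) v, 0 <= t -> Omega v ->
  `|f t y v| <= K * (1 + `|y|).
Hypothesis cl : {within [set p : R * 'rV[R]_n * 'rV[R]_m | 0 <= p.1.1],
     continuous (fun p : R * 'rV[R]_n * 'rV[R]_m => l p.1.1 p.1.2 p.2)}.
Hypothesis cf : {within [set p : R * 'rV[R]_n * 'rV[R]_m | 0 <= p.1.1],
     continuous (fun p : R * 'rV[R]_n * 'rV[R]_m => f p.1.1 p.1.2 p.2)}.
Hypothesis cO : compact Omega.
Hypothesis A6 : forall (t : R) (z : 'rV[R]_n), 0 <= t ->
  exists2 S : set 'rV[R]_n, bounded_set S &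
    forall x u, finite_cost_process l f Omega delta t z x u ->
      forall r : R, t <= r -> S (x r).

Local Notation rate := (running_rate l delta).
Local Notation process := (measured_process l f Omega delta).

Let K_ge0 : 0 <= K. Proof. exact: ltW. Qed.

Lemma finite_cost_bounded s z : 0 <= s -> exists2 M, 0 <= M &
  forall x u, finite_cost_process l f Omega delta s z x u ->
    forall t, s <= t -> `|x t| <= M.
Proof.
move=> s0; have [S /ex_strict_bound_gt0[M M0 HM] HS] := A6 z s0.
exists M; first exact: ltW.
by move=> x u P t st; apply/ltW/HM; exact: HS P t st.
Qed.

(** The infimum of the empty set is [+oo]. *)
Lemma finite_cost_exists s z : 0 <= s ->
  exists x u, finite_cost_process l f Omega delta s z x u.
Proof.
move=> s0; apply: contrapT => H.
have := V_real z s0; rewrite /value_function.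
rewrite (_ : [set j | _] = set0) ?ereal_inf0//.
apply/seteqP; split => // j [x [u [P _]]].
by apply: H; exists x, u.
Qed.

Lemma finite_cost_integrable s z x u : 0 <= s ->
  finite_cost_process l f Omega delta s z x u ->
  mu.-integrable `[s, +oo[ (EFin \o rate x u).
Proof.
move=> s0 P; have [M M0 xM] := finite_cost_bounded z s0.
apply: (rate_integrable K_ge0 delta_gt0 boundl (M := M) s0 (finite_cost_measured P)).
by move=> t; rewrite in_itv/= andbT; exact: xM P t.
Qed.

(** Up to time [t] a process agrees with its continuation after [t] by a process
of finite cost.  The running cost is integrable on bounded intervals, so the
spliced process has finite cost as well, and the bound assumed for such
processes applies to it at time [t]. *)
Lemma process_bounded s z : 0 <= s -> exists2 M, 0 <= M &
  forall x u, process s z x u -> forall t, s <= t -> `|x t| <= M.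
Proof.
move=> s0; have [M M0 HM] := finite_cost_bounded z s0; exists M => // x u P t st.
have t0 := le_trans s0 st.
have [x2 [u2 P2]] := finite_cost_exists (x t) t0.
have Pg := measured_splice st P (finite_cost_measured P2).
have ig : mu.-integrable `[s, +oo[ (EFin \o rate (splice t x x2) (splice t u u2)).
  rewrite running_rate_splice; apply: integrable_splice => //.
    exact: (rate_integrable_locally K_ge0 delta_gt0 boundl _ s0 P).
  exact: (finite_cost_integrable t0 P2).
have [Pf _] := integrable_finite_cost Pg ig.
by have := HM _ _ Pf t st; rewrite /splice lexx.
Qed.

Definition discounted_cost t (y : 'rV[R]_n) v : R := expR (- (delta * t)) * l t y v.

Lemma continuous_discounted_cost :
  continuous (fun p : R * 'rV[R]_n * 'rV[R]_m => clamp discounted_cost p.1.1 p.1.2 p.2).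
Proof.
have c1 : continuous (fun p : R * 'rV[R]_n * 'rV[R]_m => p.1.1).
  move=> p; apply: (@continuous_comp _ _ _ fst fst); exact: cvg_fst.
move=> p; apply: cvgM; last exact: (continuous_clamp3 cl).
apply: (@continuous_comp _ _ _ (fun p : R * 'rV[R]_n * 'rV[R]_m => - (delta * Num.max p.1.1 0)) expR).
  apply: cvgN; apply: cvgM; first exact: cvg_cst.
  apply: (@continuous_max _ _ (fun p : R * 'rV[R]_n * 'rV[R]_m => p.1.1) (fun=> 0)).
    exact: c1.
  exact: cvg_cst.
exact: continuous_expR.
Qed.

Lemma hamiltonian_le t (y xi : 'rV[R]_n) v : Omega v ->
  (hamiltonian l f Omega delta t y xi <= (dot xi (f t y v) + discounted_cost t y v)%:E)%E.
Proof. by move=> Ov; apply: ereal_inf_lbound; exists v. Qed.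

(** [q] is constant in time, so the pairing of [q.2] with the increment of the
state is the integral of its pairing with the velocity. *)
Lemma integrate_velocity s z x u t h (q : R * 'rV[R]_n) sg c : 0 <= s ->
  process s z x u -> s <= t -> 0 <= h ->
  {ae mu, forall r, `[t, t + h]%classic r ->
    q.1 + dot (f r (x r) (u r)) q.2 <= sg * rate x u r + c} ->
  h * q.1 + dot (x (t + h) - x t) q.2 <=
  sg * \int[mu]_(r in `[t, t + h]) rate x u r + c * h.
Proof.
move=> s0 P st h0 H; have tth : t <= t + h by rewrite lerDl.
have sth := le_trans st tth.
have [_ _ ifi _] := P.1.
have subi : (Interval (BLeft t) (BRight (t + h)) <= Interval (BLeft s) (BRight (t + h)))%O.
  by rewrite /Order.le/= !bnd_simp st.
have mI : measurable (`[t, t + h]%classic : set (measurableTypeR R)) by [].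
pose comp i r := q.2 0 i * f r (x r) (u r) 0 i.
have ic i : mu.-integrable `[t, t + h] (EFin \o comp i).
  exact: (integrableZl mI (q.2 0 i) (integrable_sub_itv subi (ifi _ i sth))).
have [is_ Es] := @Rintegral_sum R _ (index_enum 'I_n) comp _ mI ic.
have dE r : dot (f r (x r) (u r)) q.2 = \sum_i comp i r.
  by rewrite dotC.
have -> : dot (x (t + h) - x t) q.2 = \int[mu]_(r in `[t, t + h]) dot (f r (x r) (u r)) q.2.
  under eq_Rintegral do rewrite dE.
  rewrite Es dotC; apply: eq_bigr => i _.
  rewrite !mxE (process_increment i P.1 st tth) RintegralZl//.
  exact: integrable_sub_itv subi (ifi _ i sth).
have id : mu.-integrable `[t, t + h] (EFin \o (fun r => dot (f r (x r) (u r)) q.2)).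
  by apply: eq_integrable is_ => // r _; rewrite /= dE.
have i1 : mu.-integrable `[t, t + h] (EFin \o (fun r => q.1 + dot (f r (x r) (u r)) q.2)).
  apply: eq_integrable (integrableD _ (integrable_cst_itv t (t + h) q.1) id) => //.
have ig : mu.-integrable `[t, t + h] (EFin \o rate x u).
  apply: (integrable_sub_itv subi).
  exact: (rate_integrable_locally K_ge0 delta_gt0 boundl _ s0 P).
have isg : mu.-integrable `[t, t + h] (EFin \o (fun r => sg * rate x u r)).
  exact: (integrableZl mI sg ig).
have i2 : mu.-integrable `[t, t + h] (EFin \o (fun r => sg * rate x u r + c)).
  apply: eq_integrable (integrableD _ isg (integrable_cst_itv t (t + h) c)) => //.
have := le_Rintegral_ae _ i1 i2 H.
rewrite !RintegralD//; [|exact: integrable_cst_itv|exact: integrable_cst_itv].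
rewrite RintegralZl// !Rintegral_cst_itv// addrAC subrr add0r.
by rewrite (mulrC h); apply.
Qed.

(** The hypotheses on [Th], [t'], [y] and [q] are those that [inf_convolution]
provides.  The Hamilton-Jacobi inequality is assumed at [(t', y)] only, for the
control values actually used; the sign [sg] is 1 for sub-solutions and -1 for
super-solutions.  Of the error 4 e, one part each comes from the squares in the
penalty, from the Hamilton-Jacobi inequality, and from moving [f] and the
running cost from [(t', y)] to the trajectory. *)
Lemma regularized_step s z x u M (e : R) (Th : R -> 'rV[R]_n -> R) h0 t t' y q sg h : 0 <= s -> 0 <= M ->
  process s z x u -> (forall r, s <= r -> `|x r| <= M) ->
  s <= t -> 0 <= h <= h0 -> 0 <= t' ->
  (forall h D, 0 <= h <= h0 -> `|D| <= K * (1 + M) * h ->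
          Th (t + h) (x t + D) <= Th t (x t) + h * q.1 + dot D q.2 + e * h :> R) ->
  (forall r x' v, t <= r <= t + h0 -> `|x' - x t| <= K * (1 + M) * h0 -> Omega v ->
          `|dot (clamp f t' y v - clamp f r x' v) q.2| <= e /\
          `|clamp discounted_cost t' y v - clamp discounted_cost r x' v| <= e) ->
  `|sg| <= 1 ->
  {ae mu, forall r, `[t, t + h]%classic r ->
     q.1 + dot (f t' y (u r)) q.2 <= sg * discounted_cost t' y (u r) + e} ->
  Th (t + h) (x (t + h)) <= Th t (x t) + sg * \int[mu]_(r in `[t, t + h]) rate x u r + 4 * e * h.
Proof.
move=> s0 M0 P xM st /andP[h1 h2] t'0 HTh Hfg sg1 Hae.
have Lip := process_lipschitz K_ge0 boundf s0 M0 P.1 xM.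
have tth : t <= t + h by rewrite lerDl.
have KM : 0 <= K * (1 + M) by rewrite mulr_ge0// addr_ge0.
have := HTh h (x (t + h) - x t); rewrite h1 h2 (addrC (x t)) subrK => /(_ isT) HTh'.
have D1 : `|x (t + h) - x t| <= K * (1 + M) * h.
  by have := Lip t (t + h) st tth; rewrite addrAC subrr add0r.
have := @integrate_velocity s z x u t h q sg (3 * e) s0 P st h1.
have FF : Filter (nbhs (almost_everywhere mu)) by exact: ae_filter_ringOfSetsType.
have Hv : {ae mu, forall r, `[t, t + h]%classic r ->
    q.1 + dot (f r (x r) (u r)) q.2 <= sg * rate x u r + 3 * e}.
  have [[_ O] _ _ _] := P.1.
  apply: filterS2 Hae O => r Hr Or rI; have := rI; rewrite /= in_itv/= => /andP[tr rt].
  have sr := le_trans st tr; have Ov := Or sr; have r0 := le_trans s0 sr.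
  have rt0 : r <= t + h0 by rewrite (le_trans rt)// lerD2l.
  have xr : `|x r - x t| <= K * (1 + M) * h0.
    by rewrite (le_trans (Lip t r st tr))// ler_wpM2l// lerBlDl.
  have := Hfg r (x r) (u r); rewrite tr rt0 => /(_ isT xr Ov) [].
  rewrite !clampE// dotDl dotNl => /ler_normlP[f1 _] g1.
  have g2 : sg * (discounted_cost t' y (u r) - discounted_cost r (x r) (u r)) <= e.
    rewrite (le_trans (ler_norm _))// normrM (le_trans _ g1)//.
    by rewrite ler_piMl.
  have := Hr rI; rewrite /running_rate -/(discounted_cost r (x r) (u r)).
  move: g2; rewrite mulrBr; lra.
move=> /(_ Hv); have := HTh' D1; lra.
Qed.

Lemma discount_tail_small (c e : R) : 0 < e ->
  \forall T \near +oo, c * (delta^-1 * expR (- (delta * T))) < e.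
Proof.
move=> e0; have lim0 : c * (delta^-1 * expR (- (delta * T))) @[T --> +oo] --> (0 : R).
  rewrite -(mulr0 c) -(mulr0 delta^-1); apply: cvgM; first exact: cvg_cst.
  apply: cvgM; first exact: cvg_cst.
  apply: (@cvg_comp _ _ _ (fun x => delta * x) (fun x => expR (- x)) _ (+oo : set_system R)).
    exact: gt0_cvgMry.
  exact: cvgr_expR.
exact: (cvgr_lt 0 lim0).
Qed.

Lemma small_steps (s T h0 : R) : s <= T -> 0 < h0 ->
  exists (N : nat) (h : R), 0 <= h <= h0 /\ s + N%:R * h = T.
Proof.
move=> sT h00; pose N := (Num.bound ((T - s) / h0)).+1.
have N0 : 0 < N%:R :> R by rewrite ltr0n.
exists N, ((T - s) / N%:R); split; last first.
  by rewrite mulrC divfK ?gt_eqF// addrC subrK.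
rewrite divr_ge0 ?subr_ge0//= ler_pdivrMr// mulrC -ler_pdivrMr//.
apply/ltW/(@lt_trans _ _ (Num.bound ((T - s) / h0))%:R); last by rewrite ltr_nat.
by apply: archi_boundP; rewrite divr_ge0 ?subr_ge0// ltW.
Qed.

Lemma proximal_clamp (Psi Phi : R -> 'rV[R]_n -> R) t y q : 0 <= t ->
  (forall t y, 0 <= t -> Psi t y = Phi t y) ->
  proximal_subgradient Psi t y q -> proximal_subgradient Phi t y q.
Proof.
move=> t0 E [c [d [d0 H]]]; exists c, d; split => // t' y' h1 h2 h3.
by rewrite -!E//; exact: H.
Qed.

Lemma rate_split s z x u t h : 0 <= s -> process s z x u -> s <= t -> 0 <= h ->
  \int[mu]_(r in `[s, t + h]) rate x u r =
  \int[mu]_(r in `[s, t]) rate x u r + \int[mu]_(r in `[t, t + h]) rate x u r.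
Proof.
move=> s0 P st h0; apply: Rintegral_itv_split => //; first by rewrite bnd_simp lerDl.
exact: (rate_integrable_locally K_ge0 delta_gt0 boundl _ s0 P).
Qed.

(** The inequality for the Hamiltonian at a supergradient holds for every control
value, so almost every value of the given control can be used in
[regularized_step]; the steps are then added up. *)
Lemma subsolution_horizon Phi s z x u M T e : 0 <= s -> 0 <= M ->
  dini_subsolution l f Omega delta Phi ->
  process s z x u -> (forall r, s <= r -> `|x r| <= M) -> s <= T -> 0 < e ->
  Phi s z <= Phi T (x T) + \int[mu]_(r in `[s, T]) rate x u r + e.
Proof.
move=> s0 M0 [cPhi subPhi _] P xM sT e0.
have T0 := le_trans s0 sT.
have KM : 0 <= K * (1 + M) by rewrite mulr_ge0// addr_ge0.
(* The steps cost 4 e1 per unit of time, and passing to [Th] and back costs e1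
   at either end. *)
pose e1 := e / (4 * (T - s) + 2).
have den : 0 < 4 * (T - s) + 2 by lra.
have e10 : 0 < e1 by rewrite divr_gt0.
have e1E : e1 * (4 * (T - s) + 2) = e by rewrite /e1 divfK// gt_eqF.
pose Psi t y := - clamp Phi t y.
have cPsi : continuous (fun p : R * 'rV[R]_n => Psi p.1 p.2).
  by move=> p; apply: cvgN; exact: (continuous_clamp2 cPhi).
have lip t v y y' : 0 <= t -> Omega v -> `|clamp f t y v - clamp f t y' v| <= K * `|y - y'|.
  by move=> t0; rewrite clampE//; exact: lipf.
have [Th [h0 [h00 ThPsi Hreg]]] := inf_convolution cPsi (continuous_clamp3 cf)
  continuous_discounted_cost cO K_ge0 lip T0 M0 KM e10.
have [N [h [/andP[h1 h2] NT]]] := small_steps sT h00.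
have PsiE t y : 0 <= t -> Psi t y = - Phi t y by move=> t0; rewrite /Psi clampE.
have step k : (k <= N)%N ->
    Th (s + k%:R * h) (x (s + k%:R * h)) <=
    Th s z + \int[mu]_(r in `[s, s + k%:R * h]) rate x u r + 4 * e1 * (k%:R * h).
  elim: k => [|k IH] kN.
    by rewrite mul0r !addr0 mulr0 addr0 (process_start P.1) set_itv1 Rintegral_set1 addr0.
  have {}IH := IH (ltnW kN).
  set t := s + k%:R * h in IH *.
  have kh : 0 <= k%:R * h by rewrite mulr_ge0.
  have st : s <= t by rewrite /t lerDl.
  have tT : t <= T by rewrite -NT /t lerD2l ler_wpM2r// ler_nat ltnW.
  have -> : s + k.+1%:R * h = t + h by rewrite /t -natr1; ring.
  have tt : 0 <= t <= T by rewrite tT (le_trans s0 st).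
  have [t' [y [q [t'0 Hprox HTh Hfg]]]] := Hreg t (x t) tt (xM t st).
  have {}Hprox := proximal_super_dini (proximal_clamp t'0 PsiE Hprox).
  have Hv v : Omega v -> q.1 + dot (f t' y v) q.2 <= 1 * discounted_cost t' y v + e1.
    move=> Ov; have := subPhi t' y (- q.1) (- q.2) t'0 Hprox.
    move=> /le_trans/(_ (leeD2l _ (hamiltonian_le _ _ _ Ov))).
    by rewrite -EFinD lee_fin dotNl (dotC q.2); lra.
  rewrite (rate_split s0 P st h1).
  have h12 : 0 <= h <= h0 by rewrite h1.
  have := @regularized_step s z x u M e1 Th h0 t t' y q 1 h s0 M0 P xM st h12 t'0 HTh Hfg.
  rewrite normr1 lexx => /(_ isT).
  have [[_ O] _ _ _] := P.1.
  have FF : Filter (nbhs (almost_everywhere mu)) by exact: ae_filter_ringOfSetsType.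
  have ae : {ae mu, forall r, `[t, t + h]%classic r ->
     q.1 + dot (f t' y (u r)) q.2 <= 1 * discounted_cost t' y (u r) + e1}.
    apply: filterS O => r Or; rewrite /= in_itv/= => /andP[tr _].
    by apply: Hv; apply: Or; exact: le_trans st tr.
  move=> /(_ ae); rewrite mul1r -natr1 => H.
  by lra.
have := step N (leqnn N); rewrite NT.
have -> : N%:R * h = T - s by rewrite -NT; ring.
have zM : `|z| <= M by rewrite -(process_start P.1) xM.
have := ThPsi s z; have := ThPsi T (x T).
rewrite !PsiE// T0 lexx s0 sT => /(_ isT (xM T sT)) /ler_normlP[a1 a2] /(_ isT zM) /ler_normlP[a3 a4] H.
lra.
Qed.

Theorem subsolution_le_value Phi s z : 0 <= s ->
  dini_subsolution l f Omega delta Phi -> ((Phi s z)%:E <= V s z)%E.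
Proof.
move=> s0 sub; apply: le_ereal_inf_tmp => _ [x [u [P ->]]].
have Pm := finite_cost_measured P.
have [M M0 xM] := finite_cost_bounded z s0; have {}xM := xM _ _ P.
have [_ ->] := integrable_finite_cost Pm (finite_cost_integrable s0 P).
rewrite lee_fin; apply/ler_addgt0Pr => e e0; have e30 : 0 < e / 3 by rewrite divr_gt0.
have [_ _ van] := sub.
have near0 := van _ (@compact_norm_le R n M) _ e30.
have near1 := discount_tail_small (K * (1 + M)) e30.
(* The error is shared by the horizon inequality, the value of [Phi] at [T] and
   the cost after [T]. *)
have [T [sT [Phi0 tail]]] := filter_ex (filterI (nbhs_pinfty_ge (num_real s)) (filterI near0 near1)).
have := Phi0 (x T) (xM T sT) => /ltr_normlP[_ p1].
have := rate_tail K_ge0 delta_gt0 boundl s0 M0 Pm xM sT => /ler_normlP[p2 p3].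
have := subsolution_horizon s0 M0 sub Pm xM sT e30.
move: tail => /=; lra.
Qed.

(** The process is built step by step.  At the end of a step a control value that
almost attains the Hamiltonian at the subgradient is kept constant, and the
new trajectory replaces the previous one from there on.  Before the first step
any process will do. *)
Lemma supersolution_horizon Phi s z M T e : 0 <= s -> 0 <= M ->
  dini_supersolution l f Omega delta Phi ->
  (forall x u, process s z x u -> forall r, s <= r -> `|x r| <= M) ->
  s <= T -> 0 < e ->
  exists x u, process s z x u /\
    Phi T (x T) + \int[mu]_(r in `[s, T]) rate x u r <= Phi s z + e.
Proof.
move=> s0 M0 [cPhi _ supPhi] HM sT e0.
have T0 := le_trans s0 sT.
have KM : 0 <= K * (1 + M) by rewrite mulr_ge0// addr_ge0.
(* The steps cost 4 e1 per unit of time, and passing to [Th] and back costs e1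
   at either end. *)
pose e1 := e / (4 * (T - s) + 2).
have den : 0 < 4 * (T - s) + 2 by lra.
have e10 : 0 < e1 by rewrite divr_gt0.
have e1E : e1 * (4 * (T - s) + 2) = e by rewrite /e1 divfK// gt_eqF.
have lip t v y y' : 0 <= t -> Omega v -> `|clamp f t y v - clamp f t y' v| <= K * `|y - y'|.
  by move=> t0; rewrite clampE//; exact: lipf.
have [Th [h0 [h00 ThPsi Hreg]]] := inf_convolution (continuous_clamp2 cPhi) (continuous_clamp3 cf)
  continuous_discounted_cost cO K_ge0 lip T0 M0 KM e10.
have [N [h [/andP[h1 h2] NT]]] := small_steps sT h00.
have PhiE t y : 0 <= t -> clamp Phi t y = Phi t y by move=> t0; rewrite clampE.
have step k : (k <= N)%N -> exists x u, process s z x u /\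
    Th (s + k%:R * h) (x (s + k%:R * h)) +
    \int[mu]_(r in `[s, s + k%:R * h]) rate x u r <= Th s z + 4 * e1 * (k%:R * h).
  elim: k => [|k IH] kN.
    have [x [u P]] := finite_cost_exists z s0; exists x, u.
    split; first exact: finite_cost_measured.
    by rewrite mul0r !addr0 mulr0 addr0 (process_start (finite_cost_measured P).1)
      set_itv1 Rintegral_set1 addr0.
  have [x [u [P {}IH]]] := IH (ltnW kN).
  set t := s + k%:R * h in IH *.
  have kh : 0 <= k%:R * h by rewrite mulr_ge0.
  have st : s <= t by rewrite /t lerDl.
  have t0 := le_trans s0 st.
  have tT : t <= T by rewrite -NT /t lerD2l ler_wpM2r// ler_nat ltnW.
  have -> : s + k.+1%:R * h = t + h by rewrite /t -natr1; ring.
  have tt : 0 <= t <= T by rewrite tT t0.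
  have [t' [y [q [t'0 Hprox HTh Hfg]]]] := Hreg t (x t) tt (HM _ _ P t st).
  have {}Hprox := proximal_sub_dini (proximal_clamp t'0 PhiE Hprox).
  have [v Ov Hv] : exists2 v, Omega v &
      q.1 + dot (f t' y v) q.2 <= -1 * discounted_cost t' y v + e1.
    have Hq : dini_subgradient Phi t' y (q.1, q.2) by case: (q) Hprox.
    have := supPhi t' y q.1 q.2 t'0 Hq => Hle.
    have : (hamiltonian l f Omega delta t' y q.2 < (- q.1 + e1)%:E)%E.
      have : (q.1%:E + hamiltonian l f Omega delta t' y q.2 < (e1%:E))%E.
        by apply: le_lt_trans Hle _; rewrite lte_fin.
      by rewrite -lteBrDl// -EFinB addrC.
    move=> /ereal_inf_lt[_ [v Ov <-]]; rewrite lte_fin => Hlt.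
    by exists v => //; rewrite (dotC _ q.2) /discounted_cost; lra.
  have [x2 P2] := @constant_control_process R n m l f Omega delta K K0 lipf boundf cl cf t (x t) v t0 Ov.
  have Pg := measured_splice st P P2.
  exists (splice t x x2), (splice t u (fun=> v)); split => //.
  have x2t := process_start P2.1.
  have x2E r : t <= r -> splice t x x2 r = x2 r.
    move=> tr; rewrite /splice; case: leP => // rt.
    have -> : r = t by apply/le_anti; rewrite rt tr.
    by rewrite x2t.
  have x2M r : t <= r -> `|x2 r| <= M.
    by move=> tr; rewrite -x2E// (HM _ _ Pg)// (le_trans st tr).
  have tth : t <= t + h by rewrite lerDl.
  rewrite x2E// running_rate_splice Rintegral_splice_ge ?bnd_simp//; last 2 first.
  - exact: (rate_integrable_locally K_ge0 delta_gt0 boundl _ s0 P).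
  - exact: (rate_integrable_locally K_ge0 delta_gt0 boundl _ t0 P2).
  have h12 : 0 <= h <= h0 by rewrite h1.
  rewrite -x2t in HTh Hfg.
  have := @regularized_step t (x t) x2 (fun=> v) M e1 Th h0 t t' y q (-1) h t0 M0 P2 x2M (lexx t) h12 t'0 HTh Hfg.
  rewrite normrN1 lexx x2t => /(_ isT).
  have ae : {ae mu, forall r, `[t, t + h]%classic r ->
     q.1 + dot (f t' y v) q.2 <= -1 * discounted_cost t' y v + e1}.
    by apply: aeW => r _.
  move=> /(_ ae); rewrite mulN1r -natr1 => H.
  by lra.
have [x [u [P H]]] := step N (leqnn N); exists x, u; split => //.
move: H; rewrite NT.
have -> : N%:R * h = T - s by rewrite -NT; ring.
have zM : `|z| <= M by rewrite -(process_start P.1) (HM _ _ P).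
have := ThPsi s z; have := ThPsi T (x T).
rewrite !clampE// T0 lexx s0 sT => /(_ isT (HM _ _ P T sT)) /ler_normlP[a1 a2] /(_ isT zM) /ler_normlP[a3 a4] H.
lra.
Qed.

Theorem value_le_supersolution Phi s z : 0 <= s ->
  dini_supersolution l f Omega delta Phi -> (V s z <= (Phi s z)%:E)%E.
Proof.
move=> s0 sup; have [M M0 HM] := process_bounded z s0.
apply/lee_addgt0Pr => e e0; have e30 : 0 < e / 3 by rewrite divr_gt0.
have [_ van _] := sup.
have near0 := van _ (@compact_norm_le R n M) _ e30.
have near1 := discount_tail_small (K * (1 + M)) e30.
have [T [sT [Phi0 tail]]] := filter_ex (filterI (nbhs_pinfty_ge (num_real s)) (filterI near0 near1)).
have [x [u [P H]]] := supersolution_horizon s0 M0 sup HM sT e30.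
have xM := HM _ _ P.
have ig : mu.-integrable `[s, +oo[ (EFin \o rate x u).
  apply: (rate_integrable K_ge0 delta_gt0 boundl (M := M) s0 P).
  by move=> t; rewrite in_itv/= andbT; exact: xM t.
have [Pf E] := integrable_finite_cost P ig.
apply: (@le_trans _ _ (cost l delta s x u)).
  by apply: ereal_inf_lbound; exists x, u.
rewrite E -EFinD lee_fin.
have := Phi0 (x T) (xM T sT) => /ltr_normlP[p0 p1].
have := rate_tail K_ge0 delta_gt0 boundl s0 M0 P xM sT => /ler_normlP[p2 p3].
move: tail => /=; lra.
Qed.

End Comparison.

Theorem proposition15 (R : realType) (n m : nat)
  (l : R -> 'rV[R]_n -> 'rV[R]_m -> R)
  (f : R -> 'rV[R]_n -> 'rV[R]_m -> 'rV[R]_n)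
  (Omega : set 'rV[R]_m) (delta : R)
  (Omega_neq0 : Omega !=set0) (delta_gt0 : 0 < delta)
  (V_real : forall (tau : R) (z : 'rV[R]_n), 0 <= tau ->
     value_function l f Omega delta tau z \is a fin_num)
  (A1 : exists2 K1 : R, 0 < K1 &
     forall (t : R) (u : 'rV[R]_m), 0 <= t -> Omega u ->
     forall x z : 'rV[R]_n,
       `|l t x u - l t z u| + enorm (f t x u - f t z u) <= K1 * enorm (x - z))
  (A2 : exists2 K2 : R, 0 < K2 &
     forall (t : R) (x : 'rV[R]_n) (u : 'rV[R]_m), 0 <= t -> Omega u ->
       `|l t x u| + enorm (f t x u) <= K2 * (1 + enorm x))
  (A3l : {within [set p : R * 'rV[R]_n * 'rV[R]_m | 0 <= p.1.1],
     continuous (fun p : R * 'rV[R]_n * 'rV[R]_m => l p.1.1 p.1.2 p.2)})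
  (A3f : {within [set p : R * 'rV[R]_n * 'rV[R]_m | 0 <= p.1.1],
     continuous (fun p : R * 'rV[R]_n * 'rV[R]_m => f p.1.1 p.1.2 p.2)})
  (A4 : forall (t : R) (x : 'rV[R]_n), 0 <= t ->
     @convex_set R (R^o * 'rV[R]_n)%type
       [set (expR (- (delta * t)) * l t x v, f t x v) | v in Omega])
  (A5 : compact Omega)
  (A6 : forall (tau : R) (z : 'rV[R]_n), 0 <= tau ->
     exists2 S : set 'rV[R]_n, bounded_set S &
       forall (x : R -> 'rV[R]_n) (u : R -> 'rV[R]_m),
         finite_cost_process l f Omega delta tau z x u ->
         forall t : R, tau <= t -> S (x t)) :
  (forall (Phi : R -> 'rV[R]_n -> R) (s : R) (z : 'rV[R]_n),
     0 <= s -> dini_subsolution l f Omega delta Phi ->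
     ((Phi s z)%:E <= value_function l f Omega delta s z)%E) /\
  (forall (Phi : R -> 'rV[R]_n -> R) (s : R) (z : 'rV[R]_n),
     0 <= s -> dini_supersolution l f Omega delta Phi ->
     (value_function l f Omega delta s z <= (Phi s z)%:E)%E).
Proof.
have [K1 K10 H1] := A1; have [K2 K20 H2] := A2.
(* The hypotheses are in terms of Euclidean norms; [K] absorbs the factor [n] of
   [enorm_le_norm]. *)
pose K := K1 * n%:R + K2 * (n%:R + 1).
have n0 : 0 <= n%:R :> R by [].
have K1n : 0 <= K1 * n%:R by rewrite mulr_ge0// ltW.
have K2n : 0 < K2 * (n%:R + 1) by rewrite mulr_gt0// ltr_wpDl.
have K0 : 0 < K by rewrite ltr_wpDl.
have lipf t v y y' : 0 <= t -> Omega v -> `|f t y v - f t y' v| <= K * `|y - y'|.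
  move=> t0 Ov; apply: (le_trans (norm_le_enorm _)).
  have h1 : enorm (f t y v - f t y' v) <= K1 * enorm (y - y').
    by apply: le_trans (H1 t v t0 Ov y y'); rewrite lerDr.
  apply: (le_trans h1); apply: (@le_trans _ _ (K1 * (n%:R * `|y - y'|))).
    by rewrite ler_wpM2l ?(ltW K10)// enorm_le_norm.
  by rewrite mulrA ler_wpM2r// lerDl ltW.
have growth t y v : 0 <= t -> Omega v -> `|l t y v| + enorm (f t y v) <= K * (1 + `|y|).
  move=> t0 Ov; apply: (le_trans (H2 t y v t0 Ov)).
  apply: (@le_trans _ _ (K2 * (n%:R + 1) * (1 + `|y|))).
    rewrite -mulrA ler_wpM2l ?(ltW K20)//.
    have := enorm_le_norm y; have : 0 <= `|y| by []; lra.
  by rewrite ler_wpM2r ?addr_ge0// lerDr.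
have boundl t y v : 0 <= t -> Omega v -> `|l t y v| <= K * (1 + `|y|).
  by move=> t0 Ov; apply: le_trans (growth t y v t0 Ov); rewrite lerDl enorm_ge0.
have boundf t y v : 0 <= t -> Omega v -> `|f t y v| <= K * (1 + `|y|).
  move=> t0 Ov; apply: (le_trans (norm_le_enorm _)).
  by apply: le_trans (growth t y v t0 Ov); rewrite lerDr.
split=> Phi s z s0 HPhi.
- exact: (subsolution_le_value delta_gt0 K0 lipf boundl boundf A3l A3f A5 A6 z s0 HPhi).
- exact: (value_le_supersolution delta_gt0 V_real K0 lipf boundl boundf A3l A3f A5 A6 z s0 HPhi).
Qed.
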